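(* Every $2$-dimensional simplicial pseudomanifold $\Delta$ is $SE$-partitionable (i.e. its face poset is $SE$-partitionable).
   Context: **Posets.** All posets are finite and graded, with a minimum $\hat 0$ of rank $0$ and a maximum $\hat 1$; ''rank $d+1$'' means $\hat 1$ has rank $d+1$, and coatoms are the elements of rank $d$. A lower set of faces (for instance $\Gamma_\sigma$, $\partial\Gamma_\sigma$, $\partial\overline\sigma$ below) is regarded as such a poset by adjoining a maximum $\hat 1$; in particular $\{\emptyset\}$ denotes the rank-one poset $\{\hat0<\hat1\}$. The face poset of a finite simplicial complex consists of its faces (with $\emptyset$ as $\hat 0$) ordered by inclusion and an adjoined $\hat 1$; the complex is identified with its face poset. For an element $p$, $\overline p=[\hat 0,p]$; for a set $\mathcal C$ of elements, $\overline{\mathcal C}=\bigcup_{p\in\mathcal C}\overline p$; and $\partial\overline\sigma=\overline\sigma\setminus\{\sigma\}$. A poset is Eulerian if every interval $[x,y]$ with $x<y$ has as many elements of even rank as of odd rank; it is semi-Eulerian if this holds for every interval $[x,y]\ne[\hat0,\hat1]$ with $x<y$. It is near-Eulerian if it is obtained from an Eulerian poset by deleting a single coatom. For a near-Eulerian poset $\Gamma$, its boundary $\partial\Gamma$ is the closure of the set of all $y$ such that $[y,\hat1]$ is a three-element chain, and its semisuspension $\tilde\Sigma\Gamma$ is the Eulerian poset obtained from $\Gamma$ by adjoining a new coatom $\tau$ covering exactly all $y$ such that $[y,\hat 1]$ is a three-element chain. **Pseudomanifolds.** A ($d$-dimensional) pseudomanifold is a finite $d$-dimensional simplicial complex that is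 pure, in which every ridge (codimension-one face) lies in exactly two facets, and which is strongly connected: any two facets $\sigma_0,\sigma_k$ can be connected by a sequence of facets $\sigma_0,\sigma_1,\dots,\sigma_k$ such that $\sigma_i\cap\sigma_{i+1}$ is a common $(d-1)$-dimensional face for $0\le i\le k-1$. **$S$-partitionable posets** (recursive definition). An Eulerian poset $\Omega$ of rank $d+1$ is $S$-partitionable if either $\Omega=\{\emptyset\}$, or $\Omega$ has rank at least $2$ and there is a partition of $\Omega\setminus\{\hat 1\}$ with one class $P_\sigma\subseteq\overline\sigma$ for each coatom $\sigma$ (an $S$-partition) such that, writing $\Gamma_\sigma=\overline{P_\sigma\setminus\{\sigma\}}$: (a) there is a unique initial coatom $\sigma_1$ with $P_{\sigma_1}=\overline{\sigma_1}$, and $P_{\sigma_1}\setminus\{\sigma_1\}=\partial\overline{\sigma_1}$ is $S$-partitionable of rank $d$; (b) there is a unique terminal coatom $\sigma_t$ with $P_{\sigma_t}=\{\sigma_t\}$; (c) for every other coatom $\sigma$ (called ordinary), $\Gamma_\sigma$ is near-Eulerian of rank $d$, $\Gamma_\sigma=(P_\sigma\setminus\{\sigma\})\uplus\partial\Gamma_\sigma$ (disjoint union), and $\tilde\Sigma\Gamma_\sigma$ is $S$-partitionable of rank $d$ via an $S$-partition whose initial coatom is the added coatom $\tau_\sigma$. **$SE$-partitionable posets.** A semi-Eulerian poset $\Omega$ of rank $d+1$ is $SE$-partitionable if either $\Omega=\{\emptyset\}$, or $\Omega$ has rank at least $2$ and there is a partition of $\Omega\setminus\{\hat1\}$ with one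 class $P_\sigma\subseteq\overline\sigma$ for each coatom $\sigma$ (an $SE$-partition) such that: (a) there is a unique initial coatom $\sigma_1$ with $P_{\sigma_1}=\overline{\sigma_1}$, and $P_{\sigma_1}\setminus\{\sigma_1\}=\partial\overline{\sigma_1}$ is $S$-partitionable of rank $d$; (b) for every other coatom $\sigma$, either $P_\sigma=\{\sigma\}$, or $P_\sigma\setminus\{\sigma\}$ admits a partition into $k_\sigma\ge1$ disjoint sub-classes $P_\sigma^j$ such that each $\Gamma_\sigma^j=\overline{P_\sigma^j}$ is near-Eulerian of rank $d$, $\Gamma_\sigma^j=P_\sigma^j\uplus\partial\Gamma_\sigma^j$ (disjoint union), and $\tilde\Sigma\Gamma_\sigma^j$ is $S$-partitionable of rank $d$ via an $S$-partition whose initial coatom is the added coatom $\tau_\sigma^j$. *)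

(* Defs.v *)
Set Warnings "-notation-overridden".
From HB Require Import structures.
From mathcomp Require Import all_boot all_order.

Set Warnings "-redundant-canonical-projection".
Set Implicit Arguments.
Unset Strict Implicit.
Unset Printing Implicit Defensive.

Import Order.TTheory Order.DefaultSetSubsetOrder.
Local Open Scope order_scope.

(* A poset with a maximum is a [finTPOrderType]; that it also has a minimum and
   is graded is the predicate [graded]. *)

Section Intervals.
Context {d : Order.disp_t} {T : finPOrderType d}.
Implicit Types (x y p : T) (C : {set T}).

Definition itv x y : {set T} := [set z | x <= z <= y].

Definition down p : {set T} := [set z | z <= p].

Definition closure C : {set T} := \bigcup_(p in C) down p.

Definition chain C : bool := [forall x in C, forall y in C, x >=< y].

Definition covers x y : bool := (x < y) && [forall z, ~~ (x < z < y)].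

(* The length of the longest chain with maximum [x]; in a graded poset this is
   the value at [x] of the rank function. *)
Definition rank x : nat :=
  (\max_(C : {set T} | chain C && (C \subset down x)) #|C|.-1)%N.

Definition balanced x y : bool :=
  #|[set z in itv x y | ~~ odd (rank z)]| == #|[set z in itv x y | odd (rank z)]|.

End Intervals.

Section AdjoinMax.
Context {d : Order.disp_t} {T : finPOrderType d} (A : {set T}).

(* The set [A] with the induced order and a new maximum [None]. *)
Definition adjoin_max : Type := option {x : T | x \in A}.

HB.instance Definition _ := Finite.on adjoin_max.

Definition adjoin_max_le (u v : adjoin_max) : bool :=
  match u, v with
  | _, None => true
  | None, Some _ => false
  | Some x, Some y => val x <= val y
  end.

Fact adjoin_max_le_refl : reflexive adjoin_max_le.
Proof. by case=> //= x. Qed.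

Fact adjoin_max_le_anti : antisymmetric adjoin_max_le.
Proof. by move=> [x|] [y|] //= /le_anti/val_inj ->. Qed.

Fact adjoin_max_le_trans : transitive adjoin_max_le.
Proof. by move=> [y|] [x|] [z|] //=; apply: le_trans. Qed.

HB.instance Definition _ := Order.Le_isPOrder.Build d adjoin_max
  adjoin_max_le_refl adjoin_max_le_anti adjoin_max_le_trans.

Fact adjoin_max_lex1 (u : adjoin_max) : u <= (None : adjoin_max).
Proof. by case: u. Qed.

HB.instance Definition _ := Order.hasTop.Build d adjoin_max adjoin_max_lex1.

End AdjoinMax.

Section Posets.
Context {d : Order.disp_t} (T : finTPOrderType d).

Definition graded : Prop :=
  (exists b : T, forall x, b <= x) /\
  (forall x y : T, covers x y -> rank y = (rank x).+1).

Definition poset_rank : nat := rank (\top : T).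

Definition coatom : {pred T} := [pred s | (rank s).+1 == poset_rank].

Definition Eulerian : Prop :=
  graded /\ forall x y : T, x < y -> balanced x y.

Definition semi_Eulerian : Prop :=
  graded /\ forall x y : T, x < y -> itv x y != [set: T] -> balanced x y.

(* The elements y such that [y, \top] is a three-element chain. *)
Definition subboundary : {set T} :=
  [set y | (#|itv y \top| == 3) && chain (itv y \top)].

Definition boundary : {set T} := closure subboundary.

End Posets.

Arguments coatom {d} T.
Arguments subboundary {d} T.
Arguments boundary {d} T.

(* Up to isomorphism, [T] is [E] with the coatom [c] deleted. *)
Definition near_Eulerian {d : Order.disp_t} (T : finTPOrderType d) : Prop :=
  graded T /\
  exists (E : finTPOrderType d) (c : E) (f : T -> E),
    [/\ Eulerian E, c \in coatom E,
        {mono f : x y / x <= y} & f @: [set: T] = [set~ c]].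

Section Semisuspension.
Context {d : Order.disp_t} (T : finTPOrderType d).

Definition semisuspension : Type := option T.

Definition new_coatom : semisuspension := None.

HB.instance Definition _ := Finite.on semisuspension.

Definition semisuspension_le (u v : semisuspension) : bool :=
  match u, v with
  | Some x, Some y => x <= y
  | Some x, None => x \in boundary T
  | None, Some y => y == \top
  | None, None => true
  end.

Fact top_notin_boundary : (\top : T) \notin boundary T.
Proof.
apply/negP => /bigcupP[y]; rewrite !inE => /andP[/eqP card3 _].
rewrite le1x => /eqP ytop; move: card3; rewrite ytop.
rewrite (_ : itv _ _ = [set \top]) ?cards1 //.
by apply/setP => z; rewrite !inE lex1 andbT le1x.
Qed.

Fact boundary_down (x y : T) : x <= y -> y \in boundary T -> x \in boundary T.
Proof.
move=> xy /bigcupP[z zB]; rewrite inE => yz.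
by apply/bigcupP; exists z; rewrite // inE (le_trans xy).
Qed.

Fact semisuspension_le_refl : reflexive semisuspension_le.
Proof. by case=> //= x. Qed.

Fact semisuspension_le_anti : antisymmetric semisuspension_le.
Proof.
move=> [x|] [y|] //=; first by move=> /le_anti ->.
- by case/andP=> xB /eqP xtop; move: xB; rewrite xtop (negPf top_notin_boundary).
- by case/andP=> /eqP ytop; rewrite ytop (negPf top_notin_boundary).
Qed.

Fact semisuspension_le_trans : transitive semisuspension_le.
Proof.
move=> [y|] [x|] [z|] //=.
- exact: le_trans.
- exact: boundary_down.
- by move=> /eqP ->; rewrite le1x.
- by move=> _ /eqP ->; rewrite lex1.
Qed.

HB.instance Definition _ := Order.Le_isPOrder.Build d semisuspension
  semisuspension_le_refl semisuspension_le_anti semisuspension_le_trans.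

Fact semisuspension_lex1 (u : semisuspension) : u <= (Some \top : semisuspension).
Proof.
by case: u => [x|]; rewrite /Order.le /= ?lex1 ?eqxx.
Qed.

HB.instance Definition _ :=
  Order.hasTop.Build d semisuspension semisuspension_lex1.

End Semisuspension.

Section LowerSets.
Context {d : Order.disp_t} {T : finTPOrderType d}.

(* The boundary of the poset [adjoin_max G], as a set of elements of [T]. *)
Definition lower_boundary (G : {set T}) : {set T} :=
  [set val u | u : {x | x \in G} & (Some u : adjoin_max G) \in boundary (adjoin_max G)].

Definition coatom_partition (P : T -> {set T}) : Prop :=
  [/\ partition [set P s | s in coatom T] [set~ \top],
      {in coatom T &, injective P}
    & {in coatom T, forall s, P s \subset down s}].

Definition initial_coatom (P : T -> {set T}) (s : T) : Prop :=
  s \in coatom T /\ P s = down s.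

Definition terminal_coatom (P : T -> {set T}) (s : T) : Prop :=
  s \in coatom T /\ P s = [set s].

End LowerSets.

(* [S_partition P s1] : [P] is an S-partition of [T] with initial coatom [s1]. *)
Inductive S_partitionable {d : Order.disp_t} (T : finTPOrderType d) : Prop :=
  | S_partitionable_rank1 of Eulerian T & poset_rank T = 1
  | S_partitionable_via (P : T -> {set T}) (s1 : T) of S_partition P s1
with S_partition {d : Order.disp_t} (T : finTPOrderType d) :
    (T -> {set T}) -> T -> Prop :=
  | SPartition (P : T -> {set T}) (s1 st : T) (n : nat) :
      Eulerian T -> poset_rank T = n.+1 -> (1 <= n)%N ->
      coatom_partition P ->
      unique (initial_coatom P) s1 ->
      S_partitionable (adjoin_max (P s1 :\ s1)) ->
      poset_rank (adjoin_max (P s1 :\ s1)) = n ->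
      unique (terminal_coatom P) st ->
      (forall s, s \in coatom T -> s != s1 -> s != st ->
         let G := closure (P s :\ s) in
         [/\ near_Eulerian (adjoin_max G) /\ poset_rank (adjoin_max G) = n,
             G = (P s :\ s) :|: lower_boundary G,
             [disjoint P s :\ s & lower_boundary G],
             poset_rank (semisuspension (adjoin_max G)) = n
           & exists Q, S_partition Q (new_coatom (adjoin_max G))]) ->
      S_partition P s1.

Definition SE_subclass {d : Order.disp_t} {T : finTPOrderType d}
    (n : nat) (Pj : {set T}) : Prop :=
  let G := closure Pj in
  [/\ near_Eulerian (adjoin_max G) /\ poset_rank (adjoin_max G) = n,
      G = Pj :|: lower_boundary G,
      [disjoint Pj & lower_boundary G],
      poset_rank (semisuspension (adjoin_max G)) = n
    & exists Q, S_partition Q (new_coatom (adjoin_max G))].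

Definition SE_partition {d : Order.disp_t} {T : finTPOrderType d}
    (n : nat) (P : T -> {set T}) (s1 : T) : Prop :=
  [/\ coatom_partition P,
      unique (initial_coatom P) s1,
      S_partitionable (adjoin_max (P s1 :\ s1))
        /\ poset_rank (adjoin_max (P s1 :\ s1)) = n
    & forall s, s \in coatom T -> s != s1 ->
        P s = [set s] \/
        exists Ps : {set {set T}},
          [/\ (1 <= #|Ps|)%N, partition Ps (P s :\ s)
            & {in Ps, forall Pj, SE_subclass n Pj}]].

Definition SE_partitionable {d : Order.disp_t} (T : finTPOrderType d) : Prop :=
  semi_Eulerian T /\
  (poset_rank T = 1 \/
   exists (n : nat) (P : T -> {set T}) (s1 : T),
     [/\ poset_rank T = n.+1, (1 <= n)%N & SE_partition n P s1]).

(* A simplicial complex is given by its set of faces, the empty face included;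
   a face of dimension k has k + 1 elements. *)
Section SimplicialComplexes.
Context {V : finType} (K : {set {set V}}).

Definition simplicial_complex : Prop :=
  set0 \in K /\ forall s t : {set V}, s \in K -> t \subset s -> t \in K.

Definition facet (s : {set V}) : bool := maxset (mem K) s.

Definition pure_of_dim (n : nat) : Prop :=
  (\max_(s in K) #|s|)%N = n.+1 /\ forall s, facet s -> #|s| = n.+1.

(* The faces of dimension n - 1: ridges of a pure complex of dimension n. *)
Definition ridge (n : nat) (r : {set V}) : bool := (r \in K) && (#|r| == n).

Definition adjacent_facets (n : nat) : rel {set V} :=
  [rel s t | [&& facet s, facet t & ridge n (s :&: t)]].

Definition pseudomanifold (n : nat) : Prop :=
  [/\ simplicial_complex,
      pure_of_dim n,
      forall r, ridge n r -> #|[set s | facet s & r \subset s]| = 2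
    & forall s t, facet s -> facet t -> connect (adjacent_facets n) s t].

(* Faces are ordered by inclusion. *)
Definition face_poset : finTPOrderType _ := adjoin_max K.

End SimplicialComplexes.

(* Main.v *)
From mathcomp Require Import all_boot all_order.
Require Import Defs.

Set Implicit Arguments.
Unset Strict Implicit.
Unset Printing Implicit Defensive.

Import Order.TTheory Order.DefaultSetSubsetOrder.
Local Open Scope order_scope.

(** Build the surface one triangle at a time, each new triangle sharing an edge
    with an earlier one, and let every face belong to the first triangle that
    contains it. Strong connectedness provides such an order: number the facets by
    their distance to a chosen one in the adjacency graph ([connect_order]). The
    class of the first triangle is the whole closed triangle. A later triangle
    meets the earlier ones at least in an edge [r], so that the proper faces it
    adds are among its two other edges [e], [f] and their common vertex [v]
    ([new_faces]). If [v] is new, then [e] and [f] are new too and the new faces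
    form the interior of an arc with two edges ([path_subclass]). If [v] is old,
    each new edge has both ends old and forms a sub-class of its own, the interior
    of a closed edge ([cell_subclass]); at a singular vertex or when the triangle
    closes a handle there may be two of them, which is why sub-classes are needed.

    It remains to see that these pieces are near-Eulerian with the expected
    boundary and that their semisuspensions have S-partitions that start at the
    new coatom. The semisuspension of an edge is a circle with two edges and that
    of an arc with two edges is a circle with three; the boundary of the first
    triangle is a circle with three edges as well. On such a circle, start with any
    edge: with two edges the other one is terminal ([bigon_S_partition]), and with
    three the second edge takes the vertex opposite to the first and the third is
    terminal ([triangle_S_partition]).

    All Eulerian conditions are derived from the diamond property [thin], that
    intervals of length two have exactly two inner elements. In a graded poset it
    implies that intervals of length at most three are balanced
    ([thin_balanced]); this covers every interval at stake, since the posets to be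
    proved Eulerian have rank at most three, and the face poset has rank four and
    need only be semi-Eulerian. The diamond property passes from the subsets of
    the vertex set to the face poset, where at the top it is the ridge condition
    on pseudomanifolds ([face_thin]), and from there to boundaries of cells
    ([boundary_thin]) and to semisuspensions ([semi_thin]). *)

(** * Rank functions *)

Section Rank.
Context {d : Order.disp_t} {T : finPOrderType d}.
Implicit Types (x y z : T) (C : {set T}).

Lemma chainP C : reflect {in C &, forall x y, x >=< y} (chain C).
Proof.
apply: (iffP forall_inP) => [H x y xC yC|H x xC]; first exact: (forall_inP (H x xC)).
by apply/forall_inP => y yC; apply: H.
Qed.

Lemma rank_geq x C : chain C -> C \subset down x -> (#|C|.-1 <= rank x)%N.
Proof. by move=> cC Cx; apply: (leq_bigmax_cond (F := fun C => #|C|.-1)); rewrite cC. Qed.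

Lemma rank_chain x : exists C, [/\ chain C, C \subset down x & rank x = #|C|.-1].
Proof.
have c0 : @chain _ T set0 && (set0 \subset down x).
  by rewrite sub0set andbT; apply/chainP => y z; rewrite inE.
have [|C /andP[? ?] e] :=
    @eq_bigmax_cond _ (fun C => chain C && (C \subset down x)) (fun C => #|C|.-1).
  by apply/card_gt0P; exists set0.
by exists C.
Qed.

Lemma rank_lt x y : x < y -> (rank x < rank y)%N.
Proof.
move=> xy; have [C [/chainP cC /subsetP Cx ->]] := rank_chain x.
have below z : z \in x |: C -> z <= x.
  by case/setU1P => [->//|/Cx]; rewrite inE.
have yn : y \notin x |: C by apply/negP => /below /(lt_le_trans xy); rewrite ltxx.
have xC_gt0 : (0 < #|x |: C|)%N by apply/card_gt0P; exists x; rewrite setU11.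
have cD : chain (y |: (x |: C)).
  apply/chainP => u v; rewrite !in_setU1 => Hu Hv.
  have le_y w : [|| w == x | w \in C] -> w <= y.
    by rewrite -in_setU1 => /below /le_trans -> //; exact: ltW.
  case/predU1P: Hu Hv => [->|Hu] /predU1P[->|Hv]; rewrite ?comparablexx //.
  - by apply/ge_comparable/le_y.
  - by apply/le_comparable/le_y.
  case/predU1P: Hu Hv => [->|Hu] /predU1P[->|Hv]; rewrite ?comparablexx //.
  - by apply/ge_comparable/below/setU1r.
  - by apply/le_comparable/below/setU1r.
  exact: cC.
have /(rank_geq cD) : y |: (x |: C) \subset down y.
  apply/subsetP => z /setU1P[->|/below zx]; rewrite inE //.
  exact: le_trans zx (ltW xy).
rewrite cardsU1 yn /=; apply: leq_trans.
by have := subset_leq_card (subsetU1 x C); case: #|C|.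
Qed.

Lemma rank_le x y : x <= y -> (rank x <= rank y)%N.
Proof. by rewrite le_eqVlt => /predU1P[->//|/rank_lt/ltnW]. Qed.

Lemma le_rank_eq x y : x <= y -> rank x = rank y -> x = y.
Proof. by rewrite le_eqVlt => /predU1P[//|/rank_lt]; rewrite ltn_neqAle => /andP[/eqP]. Qed.

Lemma exists_cover x y : x < y -> exists2 w, x <= w & covers w y.
Proof.
move=> xy; have Px : x <= x < y by rewrite lexx.
case: (@arg_maxnP _ x (fun w => x <= w < y) (@rank _ T) Px) => w /andP[xw wy] wmax.
exists w => //; rewrite /covers wy; apply/forallP => z; apply/negP => /andP[wz zy].
have := wmax z; rewrite zy (le_trans xw (ltW wz)) => /(_ isT) /=.
by rewrite leqNgt (rank_lt wz).
Qed.

Lemma bottom_rank b : (forall x, b <= x) -> rank b = 0%N.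
Proof.
move=> bP; have [C [_ /subsetP Cb ->]] := rank_chain b.
suff /subset_leq_card : C \subset [set b] by rewrite cards1; case: #|C| => [|[]].
by apply/subsetP => z /Cb; rewrite !inE eq_le bP andbT.
Qed.

(** To compute ranks it is enough to guess them: a function that vanishes at the
    minimum and increases by one along covers is the rank function. *)
Section Unique.
Variables (r : T -> nat) (b : T).
Hypotheses (bP : forall x, b <= x) (rb : r b = 0%N).
Hypothesis (rP : forall x y, covers x y -> r y = (r x).+1).

Lemma rankfun_lt x y : x < y -> (r x < r y)%N.
Proof.
have [m] := ubnP (rank y); elim: m y => // m IH y ym xy.
have [w xw wy] := exists_cover xy; rewrite (rP wy) ltnS.
have wy' : w < y by case/andP: wy.
move: xw; rewrite le_eqVlt => /predU1P[->//|xw]; apply/ltnW/IH => //.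
exact: leq_trans (rank_lt wy') ym.
Qed.

Lemma rank_unique x : rank x = r x.
Proof.
apply/eqP; rewrite eqn_leq; apply/andP; split.
  have [C [/chainP cC /subsetP Cx ->]] := rank_chain x.
  have rC y : y \in C -> (r y < (r x).+1)%N.
    by move=> /Cx; rewrite inE le_eqVlt ltnS => /predU1P[->//|/rankfun_lt/ltnW].
  pose f y : 'I_(r x).+1 := inord (r y).
  have fI : {in C &, injective f}.
    move=> y z yC zC /(congr1 (@nat_of_ord _)); rewrite /f !inordK ?rC // => e.
    by have /comparable_ltgtP[/rankfun_lt|/rankfun_lt|] := cC _ _ yC zC; rewrite // e ltnn.
  by have := max_card [in f @: C]; rewrite card_in_imset // card_ord; case: #|C|.
have [m] := ubnP (rank x); elim: m x => // m IH x xm.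
have := bP x; rewrite le_eqVlt => /predU1P[<-|]; first by rewrite rb.
case/exists_cover => w _ wx; have wx' : w < x by case/andP: wx.
rewrite (rP wx); apply: leq_ltn_trans (rank_lt wx'); apply: IH.
exact: leq_trans (rank_lt wx') xm.
Qed.

End Unique.
End Rank.

(** * Thin posets *)

Definition mids {d : Order.disp_t} {T : finPOrderType d} (x y : T) : {set T} :=
  [set z | x < z < y].

(** The diamond property. It is what is checked in place of the Eulerian
    condition: it is local, it is inherited by the posets built below, and up to
    length three it implies that intervals are balanced. *)
Definition thin {d : Order.disp_t} (T : finTPOrderType d) : Prop :=
  forall x y : T, x <= y -> rank y = (rank x).+2 -> #|mids x y| = 2.

Section Graded.
Context {d : Order.disp_t} {T : finTPOrderType d}.
Implicit Types x y z s : T.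

Lemma gradedP (r : T -> nat) b :
  (forall x, b <= x) -> r b = 0%N ->
  (forall x y, covers x y -> r y = (r x).+1) ->
  graded T /\ rank =1 r.
Proof.
move=> bP rb rP; have rr := rank_unique bP rb rP; split=> //.
by split; [exists b | move=> x y; rewrite !rr; apply: rP].
Qed.

Lemma rank_topE : rank (\top : T) = poset_rank T.
Proof. by []. Qed.

Lemma rank_le_top x : (rank x <= poset_rank T)%N.
Proof. exact/rank_le/lex1. Qed.

Lemma rank_top x : (rank x == poset_rank T) = (x == \top).
Proof. by apply/eqP/eqP => [/(le_rank_eq (lex1 x))|->]. Qed.

Lemma coatomE x : (x \in coatom T) = ((rank x).+1 == poset_rank T).
Proof. by rewrite inE. Qed.

Lemma coatom_neq_top s : s \in coatom T -> s != \top.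
Proof. by rewrite coatomE -rank_top => /eqP <-; rewrite ltn_eqF. Qed.

Lemma coatom_max s x : s \in coatom T -> s <= x -> x != \top -> x = s.
Proof.
rewrite coatomE => /eqP sc sx xt; apply/esym/(le_rank_eq sx)/eqP.
by rewrite eqn_leq rank_le //= -ltnS sc ltn_neqAle rank_top xt rank_le_top.
Qed.

Hypothesis gT : graded T.

Lemma graded_bottom : exists2 b, forall x, b <= x & forall x, (rank x == 0%N) = (x == b).
Proof.
case: gT => [[b bP] _]; exists b => // x.
by apply/eqP/eqP => [rx|->]; [apply/esym/(le_rank_eq (bP x)) |]; rewrite bottom_rank.
Qed.

Lemma exists_rank x y k : x <= y -> (rank x <= k <= rank y)%N ->
  exists2 z, x <= z <= y & rank z = k.
Proof.
have [m] := ubnP (rank y); elim: m y => // m IH y ym xy /andP[xk].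
rewrite leq_eqVlt => /predU1P[ky|ky]; first by exists y; rewrite ?xy ?lexx.
move: xy; rewrite le_eqVlt => /predU1P[xy|/exists_cover[w xw wy]].
  by move: ky; rewrite -xy ltnNge xk.
have ry := gT.2 _ _ wy; have /ltW wy' : w < y by case/andP: wy.
have kw : (k <= rank w)%N by rewrite -ltnS -ry.
have [||z /andP[xz zw] rz] := IH w _ xw; rewrite ?xk //; first by rewrite -ltnS -ry.
by exists z => //; rewrite xz (le_trans zw).
Qed.

Lemma exists_coatom x : x != \top -> exists2 s, x <= s & s \in coatom T.
Proof.
rewrite -ltx1 => /rank_lt xt.
have [|s /andP[xs _] rs] := @exists_rank x \top (poset_rank T).-1 (lex1 x).
  by rewrite /poset_rank; case: (rank \top) xt => //= n; rewrite ltnS => -> /=.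
by exists s; rewrite // coatomE rs prednK //; apply: leq_trans xt.
Qed.

Lemma itv_mids x y : x < y -> itv x y = x |: (y |: mids x y).
Proof.
move=> xy; apply/setP => z; rewrite !inE !le_eqVlt (eq_sym x).
by case: eqVneq => [->|_] //=; rewrite ?xy ?orbT //; case: eqVneq => [->|] //=; rewrite xy.
Qed.

(** The parity of ranks may be counted from the bottom of the interval, because
    a shift of the rank at most exchanges the two classes. *)
Lemma balancedE x y : balanced x y =
  (#|[set z in itv x y | ~~ odd (rank z - rank x)]| ==
   #|[set z in itv x y | odd (rank z - rank x)]|).
Proof.
pose E (r : nat -> nat) p := [set z in itv x y | odd (r (rank z)) == p].
have EE r : (#|[set z in itv x y | ~~ odd (r (rank z))]| = #|E r false|) *
            (#|[set z in itv x y | odd (r (rank z))]| = #|E r true|).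
  by split; apply: eq_card => z; rewrite !inE; case: odd.
have shift p : E (subn^~ (rank x)) p = E id (p (+) odd (rank x)).
  apply: eq_finset => z; case zI: (z \in itv x y) => //=.
  move: zI; rewrite inE => /andP[/rank_le xz _]; rewrite oddB //.
  by case: odd; case: odd; case: p.
rewrite /balanced !(EE id) !(EE (subn^~ (rank x))) !shift.
by case: (odd (rank x)); rewrite // eq_sym.
Qed.

Hypothesis tT : thin T.

(** In length three, with [a1] elements of relative rank one and [a2] of relative
    rank two, counting the comparable pairs among them from either side gives
    [2 * a1 = 2 * a2] by thinness. *)
Lemma thin_balanced x y : x < y -> (rank y <= rank x + 3)%N -> balanced x y.
Proof.
move=> xy; rewrite balancedE.
pose A i := [set z in itv x y | rank z == rank x + i].
have [i ry] : exists i, rank y = rank x + i.+1.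
  by exists (rank y - (rank x).+1); rewrite addnS -addSn subnKC // rank_lt.
rewrite ry leq_add2l !ltnS => i2.
have inA z : z \in itv x y -> exists2 j, (j <= 3)%N & rank z = rank x + j.
  rewrite inE => /andP[xz /rank_le]; rewrite ry => zy; exists (rank z - rank x).
    by rewrite leq_subLR (leq_trans zy) // leq_add2l.
  by rewrite subnKC // rank_le.
have ev : [set z in itv x y | ~~ odd (rank z - rank x)] = A 0 :|: A 2.
  apply/setP => z; rewrite in_setU !(in_set (fun z => (z \in itv x y) && _)).
  case zI: (z \in itv x y) => //=; have [j j3 ->] := inA _ zI.
  by rewrite addKn !eqn_add2l; case: j j3 => [|[|[|[]]]].
have od : [set z in itv x y | odd (rank z - rank x)] = A 1 :|: A 3.
  apply/setP => z; rewrite in_setU !(in_set (fun z => (z \in itv x y) && _)).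
  case zI: (z \in itv x y) => //=; have [j j3 ->] := inA _ zI.
  by rewrite addKn !eqn_add2l; case: j j3 => [|[|[|[]]]].
have A0 : A 0 = [set x].
  apply/setP => z; rewrite in_set in_set1 addn0; apply/andP/eqP => [[]|->].
    by rewrite in_set => /andP[xz _] /eqP /esym /(le_rank_eq xz).
  by rewrite in_set lexx ltW.
have Ai : A i.+1 = [set y].
  apply/setP => z; rewrite in_set in_set1 -ry; apply/andP/eqP => [[]|->].
    by rewrite in_set => /andP[_ zy] /eqP /(le_rank_eq zy).
  by rewrite in_set lexx ltW.
have Agt j : (i.+1 < j)%N -> A j = set0.
  move=> ij; apply/setP => z; rewrite !inE; apply/negP => /andP[/andP[_ /rank_le]].
  by rewrite ry => + /eqP e; rewrite e leq_add2l leqNgt ij.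
have disj j k : (j < k)%N -> #|A j :|: A k| = #|A j| + #|A k|.
  move=> jk; suff e : A j :&: A k = set0 by rewrite cardsU e cards0 subn0.
  apply/setP => z; rewrite in_setI !(in_set (fun z => (z \in itv x y) && _)) in_set0.
  apply/negP => /andP[/andP[_ /eqP->] /andP[_]].
  by rewrite eqn_add2l ltn_eqF.
rewrite ev od !disj // A0 cards1.
case: i i2 ry Ai Agt => [|[|[|]]] // _ ry Ai Agt.
- by rewrite Ai !Agt // !cards0 cards1.
- rewrite Ai (Agt 3) // cards0 addn0 cards1 eq_sym; apply/eqP.
  transitivity #|mids x y|; last by rewrite tT ?ltW // ry addn2.
  apply: eq_card => z; rewrite !inE !le_eqVlt; apply/andP/andP.
    move=> [/andP[xz zy] /eqP rz]; move: xz zy rz.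
    case: eqP => [<-|_] /=; first by rewrite addn1 => _ _ /eqP; rewrite ltn_eqF.
    move=> -> /predU1P[->|->] //; rewrite ry => /eqP; by rewrite eqn_add2l.
  move=> [xz zy]; rewrite xz zy !orbT; split=> //.
  move/rank_lt: xz; move/rank_lt: zy; rewrite ry addn2 addn1 ltnS => zx xz.
  by rewrite eqn_leq zx xz.
rewrite Ai cards1 addnC eqn_add2r.
have up u : u \in A 1 -> #|[set w in A 2 | u < w]| = 2.
  rewrite in_set inE => /andP[/andP[xu uy] /eqP ru].
  transitivity #|mids u y|; last by rewrite tT // ry ru addn1 addn3.
  apply: eq_card => w.
  rewrite !inE andbC; case uw: (u < w) => //=; rewrite (le_trans xu (ltW uw)) /=.
  rewrite lt_neqAle andbC; case wy: (w <= y); rewrite ?andbF // !andbT.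
  have [->|wy'] := eqVneq w y; first by rewrite ry eqn_add2l.
  have := rank_lt uw; have /rank_lt : w < y by rewrite lt_neqAle wy' wy.
  by rewrite ry ru addn1 addn2 addn3 ltnS => a b; rewrite eqn_leq a b.
have dn w : w \in A 2 -> #|[set u in A 1 | u < w]| = 2.
  rewrite in_set inE => /andP[/andP[xw wy] /eqP rw].
  transitivity #|mids x w|; last by rewrite tT // rw addn2.
  apply: eq_card => u.
  rewrite !inE [RHS]andbC andbC; case uw: (u < w) => //=; rewrite (le_trans (ltW uw) wy) andbT.
  rewrite lt_neqAle andbC; case xu: (x <= u); rewrite ?andbF // !andbT.
  have [<-|xu'] := eqVneq x u; first by rewrite addn1 ltn_eqF.
  have := rank_lt uw; have /rank_lt : x < u by rewrite lt_neqAle xu' xu.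
  by rewrite rw addn1 addn2 ltnS => a b; rewrite eqn_leq a b.
have sum_up : (#|A 1| * 2 = \sum_(u in A 1) \sum_(w in A 2 | (u < w)%O) 1)%N.
  by rewrite -sum_nat_const; apply: eq_bigr => u uA; rewrite sum1dep_card up.
have sum_dn : (#|A 2| * 2 = \sum_(w in A 2) \sum_(u in A 1 | (u < w)%O) 1)%N.
  by rewrite -sum_nat_const; apply: eq_bigr => w wA; rewrite sum1dep_card dn.
rewrite -(eqn_pmul2r (isT : (0 < 2)%N)) sum_up sum_dn; apply/eqP.
rewrite (exchange_big_dep (mem (A 1))) /=; last by move=> w u _ /andP[].
by apply: eq_bigr => u uA; apply: eq_bigl => w; rewrite uA.
Qed.

Lemma thin_Eulerian : (poset_rank T <= 3)%N -> Eulerian T.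
Proof.
move=> T3; split=> // x y xy; apply: thin_balanced => //.
by rewrite (leq_trans (rank_le_top _)) // (leq_trans T3) // leq_addl.
Qed.

(** In rank four the only interval of length greater than three is the whole
    poset, which a semi-Eulerian poset leaves unconstrained. *)
Lemma thin_semi_Eulerian : (poset_rank T <= 4)%N -> semi_Eulerian T.
Proof.
move=> T4; split=> // x y xy xyT; apply: thin_balanced => //.
rewrite leqNgt; apply/negP => r; move/eqP: xyT; apply.
have [b bP br] := graded_bottom.
have x0 : x = b.
  apply/eqP; rewrite -br -leqn0 -(leq_add2r 3) -ltnS add0n.
  exact: leq_trans r (leq_trans (rank_le_top _) T4).
have y1 : y = \top.
  apply/eqP; rewrite -rank_top eqn_leq rank_le_top (leq_trans T4) //.
  by apply: leq_trans r; rewrite -addnS leq_addl.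
by apply/setP => z; rewrite !inE x0 y1 bP lex1.
Qed.

End Graded.

(** * Adjoined maxima and semisuspensions *)

Definition above {d : Order.disp_t} {T : finPOrderType d} (G : {set T}) (x : T) : {set T} :=
  [set y in G | x < y].

(** The lower sets [G] for which [adjoin_max G] is graded of rank [m.+1]. *)
Definition pure_ideal {d : Order.disp_t} {T : finPOrderType d} (G : {set T}) m : Prop :=
  [/\ G != set0, forall x y : T, x <= y -> y \in G -> x \in G
    & forall x, x \in G -> exists y, [/\ y \in G, x <= y & rank y = m]].

Section AdjoinMaxTheory.
Context {d : Order.disp_t} {T : finTPOrderType d} (G : {set T}).
Implicit Types u v : {x : T | x \in G}.
Local Notation aG := (adjoin_max G).

Lemma adjoin_le u v : ((Some u : aG) <= Some v) = (val u <= val v).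
Proof. by []. Qed.

Lemma adjoin_lt u v : ((Some u : aG) < Some v) = (val u < val v).
Proof. by rewrite !lt_neqAle. Qed.

Lemma adjoin_ltN u : (Some u : aG) < None.
Proof. by rewrite lt_neqAle. Qed.

Lemma adjoin_Nlt u : ((None : aG) < Some u) = false.
Proof. by rewrite lt_neqAle. Qed.

(** Transfers a count in [adjoin_max G], an option over a subtype, to a count in
    the ambient poset. *)
Lemma card_adjoin (A : {set aG}) (B : {set T}) :
  None \notin A -> B \subset G -> (forall u, (Some u \in A) = (val u \in B)) ->
  #|A| = #|B|.
Proof.
move=> NA /subsetP BG AB; pose U := [set u : {x : T | x \in G} | val u \in B].
have -> : B = val @: U.
  apply/setP => x; apply/idP/imsetP => [xB|[u + ->]]; last by rewrite inE.
  by exists (Sub x (BG x xB)); rewrite ?inE SubK.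
have -> : A = Some @: U.
  apply/setP => -[u|]; last first.
    by rewrite (negPf NA); apply/esym/imsetP => -[].
  by rewrite AB mem_imset ?inE //; apply: Some_inj.
by rewrite !card_imset //; [apply: val_inj | apply: Some_inj].
Qed.

Hypotheses (gT : graded T).
Variable m : nat.
Hypothesis pG : pure_ideal G m.

Lemma adjoin_gradedE : graded aG /\
  (forall o : aG, rank o = if o is Some u then rank (val u) else m.+1).
Proof.
have [b bP br] := graded_bottom gT; have [/set0Pn[x0 x0G] lG uG] := pG.
have bG : b \in G by apply: lG x0G.
apply: (@gradedP _ _ _ (Some (Sub b bG) : aG)) => [[u|]||[u|] [v|]] //=.
- by rewrite adjoin_le.
- exact: bottom_rank.
- move=> /andP[]; rewrite adjoin_lt => uv /forallP H; apply: gT.2.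
  rewrite /covers uv; apply/forallP => z; apply/negP => /andP[uz zv].
  have zG : z \in G by apply: lG (valP v); apply: ltW.
  by have := H (Some (Sub z zG)); rewrite !adjoin_lt SubK uz zv.
- move=> /andP[_ /forallP H]; have [y [yG uy <-]] := uG _ (valP u); congr (rank _).+1.
  move: uy; rewrite le_eqVlt => /predU1P[//|uy].
  by have := H (Some (Sub y yG)); rewrite adjoin_lt adjoin_ltN SubK uy.
Qed.

Lemma adjoin_graded : graded aG.
Proof. exact: adjoin_gradedE.1. Qed.

Lemma adjoin_rank u : rank (Some u : aG) = rank (val u).
Proof. exact: adjoin_gradedE.2. Qed.

Lemma adjoin_poset_rank : poset_rank aG = m.+1.
Proof. exact: adjoin_gradedE.2. Qed.

Lemma adjoin_mids u v : #|mids (Some u : aG) (Some v)| = #|mids (val u) (val v)|.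
Proof.
have [_ lG _] := pG; apply: card_adjoin => [||w].
- by rewrite inE adjoin_Nlt andbF.
- by apply/subsetP => z; rewrite inE => /andP[_ /ltW/lG]; apply; apply: valP.
- by rewrite !inE !adjoin_lt.
Qed.

Lemma adjoin_midsN u : #|mids (Some u : aG) None| = #|above G (val u)|.
Proof.
apply: card_adjoin => [||w].
- by rewrite inE ltxx andbF.
- by apply/subsetP => z; rewrite inE => /andP[].
- by rewrite !inE adjoin_lt adjoin_ltN andbT (valP w).
Qed.

Lemma adjoin_thin : thin T ->
  (forall x, x \in G -> m = (rank x).+1 -> #|above G x| = 2) ->
  thin aG.
Proof.
move=> tT H [u|] [v|] //; rewrite ?adjoin_rank ?adjoin_poset_rank.
- by rewrite adjoin_le adjoin_mids; apply: tT.
- rewrite (_ : rank _ = m.+1) ?adjoin_midsN; last exact: adjoin_poset_rank.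
  by move=> _ [/H]; apply; apply: valP.
- by move=> _ /eqP; rewrite ltn_eqF.
Qed.

End AdjoinMaxTheory.

Section SemisuspensionTheory.
Context {d : Order.disp_t} {T : finTPOrderType d}.
Local Notation S := (semisuspension T).
Hypothesis gT : graded T.

(** Gradedness turns the order-theoretic definition of the subboundary into a
    count: the ridges that lie in exactly one coatom. *)
Lemma subboundaryE y :
  (y \in subboundary T) = ((rank y).+2 == poset_rank T) && (#|mids y \top| == 1).
Proof.
have card_itv : y < \top -> #|itv y \top| = #|mids y \top|.+2.
  move=> yt; rewrite itv_mids // !cardsU1 !inE !ltxx /= andbF.
  by rewrite lt_eqF //.
rewrite inE; apply/andP/andP => [[c3 /chainP ch]|[/eqP ry /cards1P[z zE]]].
  have yt : y < \top.
    rewrite lt_neqAle lex1 andbT; apply: contraL c3 => /eqP ->.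
    rewrite (_ : itv _ _ = [set \top]) ?cards1 //.
    by apply/setP => z; rewrite !inE lex1 andbT le1x.
  move: c3; rewrite card_itv // !eqSS => m1; split=> //.
  have /cards1P[z zE] := m1; have : z \in mids y \top by rewrite zE inE.
  rewrite inE => /andP[yz zt]; rewrite /poset_rank.
  rewrite (@gT.2 z \top) ?(@gT.2 y z) //.
    rewrite /covers yz; apply/forallP => w; apply/negP => /andP[yw wz].
    have : w \in mids y \top by rewrite inE yw (lt_trans wz).
    by rewrite zE inE => /eqP wz'; rewrite wz' ltxx in wz.
  rewrite /covers zt; apply/forallP => w; apply/negP => /andP[zw wt].
  have : w \in mids y \top by rewrite inE wt (lt_trans yz).
  by rewrite zE inE => /eqP wz'; rewrite wz' ltxx in zw.
have yt : y < \top.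
  by rewrite lt_neqAle lex1 andbT -rank_top -ry ltn_eqF.
rewrite card_itv // zE cards1; split=> //; apply/chainP.
have : z \in mids y \top by rewrite zE inE.
rewrite inE => /andP[yz zt] u v.
have {}yz := ltW yz; have {}zt := ltW zt; have {}yt := ltW yt.
rewrite itv_mids ?lt_neqAle -?rank_top -?ry ?ltn_eqF ?lex1 // zE !inE.
by move=> /or3P[]/eqP-> /or3P[]/eqP->; rewrite /Order.comparable ?lexx ?yz ?zt ?yt ?orbT.
Qed.

Lemma semi_le (x y : T) : ((Some x : S) <= Some y) = (x <= y).
Proof. by []. Qed.

Lemma semi_lt (x y : T) : ((Some x : S) < Some y) = (x < y).
Proof. by rewrite !lt_neqAle. Qed.

Lemma semi_ltN (x : T) : ((Some x : S) < None) = (x \in boundary T).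
Proof. by rewrite lt_neqAle. Qed.

Lemma semi_Nlt (x : T) : ((None : S) < Some x) = (x == \top).
Proof. by rewrite lt_neqAle. Qed.

Lemma boundaryP x : reflect (exists2 y, y \in subboundary T & x <= y) (x \in boundary T).
Proof.
by apply: (iffP bigcupP) => -[y yB xy]; exists y => //; move: xy; rewrite inE.
Qed.

Hypothesis B0 : subboundary T != set0.
Variable n : nat.
Hypothesis rT : poset_rank T = n.+1.

Lemma semi_gradedE : graded S /\
  (forall o : S, rank o = if o is Some x then rank x else n).
Proof.
have [b bP br] := graded_bottom gT; have /set0Pn[y0 y0B] := B0.
apply: (@gradedP _ _ _ (Some b : S)) => [[x|]||[x|] [y|]] //=.
- by rewrite semi_le.
- by apply: ltW; rewrite semi_ltN; apply/boundaryP; exists y0.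
- exact: bottom_rank.
- move=> /andP[]; rewrite semi_lt => xy /forallP H; apply: gT.2.
  by rewrite /covers xy; apply/forallP => z; have := H (Some z); rewrite !semi_lt.
- move=> /andP[]; rewrite semi_ltN => /boundaryP[y yB xy] /forallP H.
  have := yB; rewrite subboundaryE rT eqSS => /andP[/eqP <- _]; congr (rank _).+1.
  move: xy; rewrite le_eqVlt => /predU1P[//|xy].
  have := H (Some y); rewrite semi_lt xy semi_ltN /= => /boundaryP[].
  by exists y.
- by move=> /andP[]; rewrite semi_Nlt => /eqP->.
Qed.

Lemma semi_graded : graded S.
Proof. exact: semi_gradedE.1. Qed.

Lemma semi_rank (x : T) : rank (Some x : S) = rank x.
Proof. exact: semi_gradedE.2. Qed.

Lemma semi_rankN : rank (None : S) = n.
Proof. exact: semi_gradedE.2. Qed.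

Lemma semi_poset_rank : poset_rank S = n.+1.
Proof. by rewrite -rT; apply: semi_gradedE.2. Qed.

Lemma new_coatom_coatom : new_coatom T \in coatom S.
Proof. by rewrite coatomE semi_rankN semi_poset_rank. Qed.

Hypothesis n2 : (n <= 2)%N.
Hypothesis below_thin : forall x y : T,
  y != \top -> x <= y -> rank y = (rank x).+2 -> #|mids x y| = 2.
Hypothesis ridge_le2 : forall x : T, (rank x).+1 = n -> (#|mids x \top| <= 2)%N.
Hypothesis card_B : n = 2 -> #|subboundary T| = 2.

Lemma boundary_subboundary x : (rank x).+1 = n -> (x \in boundary T) = (x \in subboundary T).
Proof.
move=> rx; apply/boundaryP/idP => [[y yB xy]|xB]; last by exists x.
rewrite (_ : x = y) //; apply: le_rank_eq => //.
by move: yB; rewrite subboundaryE rT -rx => /andP[/eqP[->]].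
Qed.

(** The new coatom restores thinness at the top: a ridge that lay in one coatom
    only, hence in the subboundary, gains the new one as second coatom, and a
    ridge in two coatoms gains nothing. Below the new coatom itself only the case
    [n = 2] has a condition to verify, namely two subboundary elements above the
    minimum, like the two end points of an arc. *)
Lemma semi_thin : thin S.
Proof.
move=> [x|] [y|]; rewrite ?semi_rankN ?semi_rank.
- rewrite semi_le => xy ry; have [yt|yt] := eqVneq y \top; last first.
    rewrite -(below_thin yt xy ry) -(card_imset (mids x y) (@Some_inj _)).
    apply: eq_card => -[z|]; last first.
      by rewrite inE semi_ltN semi_Nlt (negPf yt) andbF; apply/esym/imsetP => -[].
    by rewrite mem_imset ?inE ?semi_lt //; apply: Some_inj.
  have {ry} rx : (rank x).+1 = n by move: ry rT; rewrite yt /poset_rank => -> [].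
  have xt : x < \top by rewrite lt_neqAle lex1 andbT -rank_top rT -rx ltn_eqF.
  rewrite (cardsD1 None) inE semi_ltN semi_Nlt yt eqxx andbT.
  have -> : #|mids (Some x : S) (Some \top) :\ None| = #|mids x \top|.
    rewrite -(card_imset (mids x \top) (@Some_inj _)); apply: eq_card => -[z|].
      by rewrite mem_imset ?inE ?semi_lt //; apply: Some_inj.
    by rewrite !inE; apply/esym/imsetP => -[].
  rewrite boundary_subboundary // subboundaryE rT rx eqxx /=.
  have := ridge_le2 rx; have : (0 < #|mids x \top|)%N.
    have [|z /andP[xz zt] rz] := @exists_rank _ _ gT x \top n (lex1 x).
      by rewrite -[rank \top]/(poset_rank T) rT -rx !leqnSn.
    apply/card_gt0P; exists z; rewrite inE !lt_neqAle xz zt !andbT -rank_top rz rT ltn_eqF //.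
    by rewrite andbT; apply/eqP => e; move: rx; rewrite e rz => /eqP; rewrite eq_sym ltn_eqF.
  by case: #|mids x \top| => [|[|[|]]].
- move=> _ nx; have n2' : n = 2 by apply/eqP; rewrite eqn_leq n2 nx.
  have rx : rank x = 0%N by move: nx; rewrite n2' => -[].
  have [b bP br] := graded_bottom gT.
  have xb : x = b by apply/eqP; rewrite -br rx.
  rewrite -(card_B n2') -(card_imset (subboundary T) (@Some_inj _)).
  apply: eq_card => -[z|]; last first.
    by rewrite inE ltxx andbF; apply/esym/imsetP => -[].
  rewrite mem_imset; last exact: Some_inj.
  rewrite [LHS]inE semi_lt semi_ltN; apply/andP/idP => [[xz zB]|zB].
    rewrite -boundary_subboundary //; apply/eqP; rewrite n2' eqSS eqn_leq.
    have := rank_lt xz; rewrite rx => -> ; rewrite andbT.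
    have /boundaryP[w + zw] := zB; rewrite subboundaryE rT n2' => /andP[/eqP[<-] _].
    exact: rank_le.
  have := zB; rewrite subboundaryE rT n2' => /andP[/eqP[rz] _]; split.
    by rewrite lt_neqAle xb bP andbT eq_sym -br rz.
  by rewrite boundary_subboundary ?rz.
- by move=> _ ry; have := rank_le_top y; rewrite rT ry ltnn.
- by move=> _ /eqP; rewrite ltn_eqF.
Qed.

Lemma semi_near_Eulerian : near_Eulerian T.
Proof.
split=> //; exists S, (new_coatom T), (@Some T); split.
- by apply: (thin_Eulerian semi_graded semi_thin); rewrite semi_poset_rank.
- exact: new_coatom_coatom.
- by move=> x y.
- by apply/setP => -[x|]; rewrite !inE; [apply/imset_f | apply/negbTE/imsetP => -[]].
Qed.

End SemisuspensionTheory.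

(** * Partitions by owners and bigons *)

Section Closure.
Context {d : Order.disp_t} {T : finPOrderType d}.

Lemma closureP (C : {set T}) x : reflect (exists2 y, y \in C & x <= y) (x \in closure C).
Proof.
by apply: (iffP bigcupP) => -[y yC xy]; exists y => //; move: xy; rewrite inE.
Qed.

End Closure.

(** Partitions indexed by coatoms are described by the function [o] that sends an
    element to the coatom whose class contains it. *)
Definition owner_class {d : Order.disp_t} {T : finTPOrderType d} (o : T -> T) (s : T) :
  {set T} := [set x | (x != \top) && (o x == s)].

Section Owner.
Context {d : Order.disp_t} {T : finTPOrderType d} (o : T -> T).
Hypothesis oP : forall x, x != \top -> o x \in coatom T /\ x <= o x.

Lemma owner_coatom s : s \in coatom T -> o s = s.
Proof.
move=> sc; have [oc so] := oP (coatom_neq_top sc).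
exact: coatom_max sc so (coatom_neq_top oc).
Qed.

Lemma mem_owner_class s : s \in coatom T -> s \in owner_class o s.
Proof. by move=> sc; rewrite inE coatom_neq_top // owner_coatom ?eqxx. Qed.

Lemma owner_partition : coatom_partition (owner_class o).
Proof.
have inj : {in coatom T &, injective (owner_class o)}.
  move=> s t sc tc e; have := mem_owner_class sc; rewrite e inE owner_coatom //.
  by case/andP=> _ /eqP.
split=> //; last first.
  by move=> s sc; apply/subsetP => x; rewrite !inE => /andP[/oP[_ +] /eqP <-].
apply/and3P; split.
- apply/eqP/setP => x; rewrite !inE; apply/bigcupP/idP => [[_ /imsetP[s _ ->]]|xt].
    by rewrite inE => /andP[].
  by exists (owner_class o (o x)); rewrite ?inE ?xt ?eqxx // imset_f // (oP xt).1.
- apply/trivIsetP => _ _ /imsetP[s _ ->] /imsetP[t _ ->] st.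
  apply/pred0P => x /=; rewrite !inE; apply/negP => /andP[/andP[_ /eqP os] /andP[_ /eqP ot]].
  by move/eqP: st; rewrite -os -ot.
- apply/imsetP => -[s /mem_owner_class + e].
  by rewrite -e inE.
Qed.

(** Uniqueness holds because the minimum lies in only one class. *)
Lemma owner_initial s1 : graded T -> s1 \in coatom T -> (0 < rank s1)%N ->
  (forall x, x != \top -> (o x == s1) = (x <= s1)) ->
  owner_class o s1 = down s1 /\ unique (initial_coatom (owner_class o)) s1.
Proof.
move=> gT s1c rs1 o1; have [b bP br] := graded_bottom gT.
have P1 : owner_class o s1 = down s1.
  apply/setP => x; rewrite !inE; have [->|xt] /= := eqVneq x \top.
    by rewrite le1x; apply/esym/negbTE/coatom_neq_top.
  exact: o1.
split=> //; split=> // s [sc Ps].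
have : b \in owner_class o s by rewrite Ps inE.
by rewrite inE => /andP[bt /eqP <-]; apply/esym/eqP; rewrite o1.
Qed.

End Owner.

(** The boundary of a cell [s] is, as a poset, the interval from the minimum to
    [s], with the adjoined maximum in place of [s]; so it inherits gradedness and
    thinness. *)
Section Boundary.
Context {d : Order.disp_t} {T : finTPOrderType d}.
Hypotheses (gT : graded T) (tT : thin T).
Variables (s : T) (m : nat).
Hypothesis rs : rank s = m.+1.

Lemma boundary_pure : pure_ideal (down s :\ s) m.
Proof.
have [b bP br] := graded_bottom gT; split.
- by apply/set0Pn; exists b; rewrite !inE bP andbT eq_sym -br rs.
- move=> x y xy; rewrite !inE => /andP[ys yles]; rewrite (le_trans xy) // andbT.
  by apply: contra ys => /eqP xs; rewrite eq_le yles -xs.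
- move=> x; rewrite !inE => /andP[xs xles].
  have [|z /andP[xz zs] rz] := @exists_rank _ _ gT x s m xles.
    by rewrite rs leqnSn andbT -ltnS -rs rank_lt // lt_neqAle xs.
  exists z; split=> //; rewrite !inE zs andbT; apply: contraTneq isT => zs'.
  by move: rs; rewrite -zs' rz => /eqP; rewrite ltn_eqF.
Qed.

Lemma boundary_graded : graded (adjoin_max (down s :\ s)).
Proof. exact: adjoin_graded boundary_pure. Qed.

Lemma boundary_poset_rank : poset_rank (adjoin_max (down s :\ s)) = m.+1.
Proof. exact: adjoin_poset_rank boundary_pure. Qed.

Lemma boundary_thin : thin (adjoin_max (down s :\ s)).
Proof.
apply: (adjoin_thin gT boundary_pure tT) => x; rewrite !inE => /andP[_ xs] mx.
rewrite -(tT xs) ?rs ?mx //; apply: eq_card => y; rewrite !inE andbC.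
by congr andb; rewrite lt_neqAle.
Qed.

End Boundary.

Section SPartitions.
Context {d : Order.disp_t}.
Implicit Types T : finTPOrderType d.

Lemma rank1_S_partitionable T :
  graded T -> thin T -> poset_rank T = 1 -> S_partitionable T.
Proof.
by move=> gT tT r1; apply: S_partitionable_rank1 => //; apply: thin_Eulerian => //; rewrite r1.
Qed.

(** The form in which all S-partitions below are produced. The classes of the
    ordinary coatoms have to satisfy the same condition as the sub-classes of an
    SE-partition, one dimension lower; non-emptiness keeps these coatoms from
    being terminal. *)
Lemma S_partition_owner T (o : T -> T) s1 st n :
  graded T -> thin T -> poset_rank T = n.+1 -> (1 <= n <= 2)%N ->
  (forall x, x != \top -> o x \in coatom T /\ x <= o x) ->
  s1 \in coatom T -> (forall x, x != \top -> (o x == s1) = (x <= s1)) ->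
  st \in coatom T -> (forall x, x != \top -> o x = st -> x = st) ->
  (forall s, s \in coatom T -> s != s1 -> s != st ->
     owner_class o s :\ s != set0 /\ SE_subclass n (owner_class o s :\ s)) ->
  S_partitionable (adjoin_max (down s1 :\ s1)) ->
  S_partition (owner_class o) s1.
Proof.
move=> gT tT rT /andP[n1 n2] oP s1c o1 stc ot oord S1.
have [b bP br] := graded_bottom gT.
have rs1 : rank s1 = n by apply/eqP; rewrite -eqSS -rT -coatomE.
have [|P1 init1] := owner_initial gT s1c _ o1; first by rewrite rs1.
have bs1 : b != s1 by rewrite eq_sym -br rs1 -lt0n.
apply: (@SPartition _ _ _ _ st n) => //.
- by apply: thin_Eulerian; rewrite // rT ltnS.
- exact: owner_partition.
- by rewrite P1.
- by case: n n1 n2 rT rs1 oord => // n _ _ _ rs1 _; rewrite P1; apply: boundary_poset_rank.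
- split=> [|s [sc Ps]].
    split=> //; apply/setP => x; rewrite in_set in_set1; apply/andP/eqP => [[xt /eqP]|->].
      exact: ot.
    by rewrite coatom_neq_top // owner_coatom.
  have [ss1|ss1] := eqVneq s s1.
    have : b \in owner_class o s by rewrite ss1 P1 inE.
    by rewrite Ps inE ss1 (negPf bs1).
  apply/eqP; rewrite eq_sym; apply: contraT => sst.
  by have [/eqP[]] := oord _ sc ss1 sst; rewrite Ps setDv.
- by move=> s sc ss1 sst; have [] := oord _ sc ss1 sst.
Qed.

Lemma other_coatom T (s x : T) : graded T -> thin T -> s \in coatom T ->
  x < s -> exists2 t, t \in coatom T & (t != s) && (x <= t).
Proof.
move=> gT tT; rewrite coatomE => /eqP sc xs; have := rank_lt xs; case rs: (rank s) => [//|k].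
rewrite ltnS => xk; have [|z /andP[xz zs] rz] := @exists_rank _ _ gT x s k (ltW xs).
  by rewrite xk rs leqnSn.
have : (1 < #|mids z \top|)%N.
  by rewrite tT ?lex1 // rz -[rank \top]/(poset_rank T) -sc rs.
rewrite (cardsD1 s) => lt1; have : (0 < #|mids z \top :\ s|)%N.
  by move: lt1; case: (s \in _) => //; apply: leq_trans.
case/card_gt0P => t; rewrite !inE => /and3P[ts zt tt].
exists t; rewrite ?ts ?(le_trans xz) ?ltW // coatomE -sc rs eqSS.
have := rank_lt zt; have := rank_lt tt; rewrite -[rank \top]/(poset_rank T) -sc rs rz.
by move=> a b; rewrite eqn_leq b -ltnS a.
Qed.

(** A sphere with two cells [s1] and [e]: each proper face of [e] lies on a second
    coatom, which is [s1], so the initial class takes everything but [e]. *)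
Lemma bigon_of_boundary T (s1 e : T) n :
  graded T -> thin T -> poset_rank T = n.+1 -> (1 <= n <= 2)%N ->
  coatom T =i [set s1; e] -> s1 != e ->
  S_partitionable (adjoin_max (down s1 :\ s1)) ->
  exists P, S_partition P s1.
Proof.
move=> gT tT rT n12 cT s1e S1.
have s1c : s1 \in coatom T by rewrite cT !inE eqxx.
have ec : e \in coatom T by rewrite cT !inE eqxx orbT.
pose o x := if x <= s1 then s1 else e.
exists (owner_class o); apply: (S_partition_owner (st := e) gT tT rT) => //.
- move=> x xt; rewrite /o; case: ifPn => // xs1; split=> //.
  have [s xs] := exists_coatom gT xt; rewrite cT !inE => /pred2P[] es; last by rewrite -es.
  by rewrite -es xs in xs1.
- by move=> x _; rewrite /o; case: ifP; rewrite ?eqxx // eq_sym (negPf s1e).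
- move=> x xt; rewrite /o; case: ifPn => [_ /eqP|xs1 _]; first by rewrite (negPf s1e).
  have [s xs] := exists_coatom gT xt; rewrite cT !inE => /pred2P[]se.
    by rewrite -se xs in xs1.
  move: xs; rewrite se le_eqVlt => /predU1P[//|xe].
  have [t] := other_coatom gT tT ec xe; rewrite cT !inE => /pred2P[->|->].
    by rewrite (negPf xs1) andbF.
  by rewrite eqxx.
- by move=> s; rewrite cT !inE => /pred2P[]->; rewrite eqxx.
Qed.

(** The zero-sphere is a bigon: thinness of the whole interval forces exactly two
    coatoms. *)
Lemma diamond_S_partition T (s1 : T) :
  graded T -> thin T -> poset_rank T = 2 -> s1 \in coatom T ->
  exists P, S_partition P s1.
Proof.
move=> gT tT rT s1c; have [b bP br] := graded_bottom gT.
have rs1 : rank s1 = 1 by apply/eqP; rewrite -eqSS -rT -coatomE.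
have b1 x : rank x = 1 -> b < x by move=> rx; rewrite lt_neqAle bP eq_sym -br rx.
have [e ec es1] := other_coatom gT tT s1c (b1 _ rs1).
have {es1} /andP[es1 _] := es1.
have cT : coatom T =i mids b \top.
  move=> x; rewrite coatomE rT eqSS inE; apply/eqP/andP => [rx|[]].
    by rewrite b1 // lt_neqAle lex1 -rank_top rT rx.
  move=> /rank_lt; rewrite (bottom_rank bP) => + /rank_lt.
  by rewrite -[rank \top]/(poset_rank T) rT; case: rank => [|[]].
apply: (bigon_of_boundary gT tT rT (e := e)) => //; last 2 first.
- by rewrite eq_sym.
- by apply: rank1_S_partitionable;
    [apply: boundary_graded rs1|apply: boundary_thin rs1|apply: boundary_poset_rank rs1].
have sub : [set s1; e] \subset mids b \top.
  by apply/subsetP => x; rewrite -cT => /set2P[]->.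
move=> x; rewrite cT; suff /eqP <- : [set s1; e] == mids b \top by [].
rewrite eqEcard sub /= cards2 eq_sym es1 tT ?lex1 // (bottom_rank bP).
exact: rT.
Qed.

Lemma boundary_S_partitionable T (s : T) n :
  graded T -> thin T -> rank s = n -> (1 <= n <= 2)%N ->
  S_partitionable (adjoin_max (down s :\ s)).
Proof.
move=> gT tT; case: n => [|[|[|n]]] // rs _.
  by apply: rank1_S_partitionable;
    [apply: boundary_graded rs|apply: boundary_thin rs|apply: boundary_poset_rank rs].
have gB := boundary_graded gT rs; have tB := boundary_thin gT tT rs.
have rB := boundary_poset_rank gT rs.
have [b bP br] := graded_bottom gB.
have [|s1 _ s1c] := exists_coatom gB (x := b).
  by rewrite -rank_top rB (bottom_rank bP).
have [P SP] := diamond_S_partition gB tB rB s1c.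
exact: S_partitionable_via SP.
Qed.

Lemma bigon_S_partition T (s1 e : T) n :
  graded T -> thin T -> poset_rank T = n.+1 -> (1 <= n <= 2)%N ->
  coatom T =i [set s1; e] -> s1 != e -> exists P, S_partition P s1.
Proof.
move=> gT tT rT n12 cT s1e; apply: (bigon_of_boundary gT tT rT n12 cT s1e).
apply: (boundary_S_partitionable gT tT _ n12); apply/eqP.
by rewrite -eqSS -rT -coatomE cT !inE eqxx.
Qed.

End SPartitions.

(** * Cells, triangles and arcs *)

(** The ridges of [G] that lie in a single facet: the image in the ambient poset
    of the subboundary of [adjoin_max G]. *)
Definition rim {d : Order.disp_t} {T : finPOrderType d} (G : {set T}) (m : nat) : {set T} :=
  [set x in G | ((rank x).+1 == m) && (#|above G x| == 1)].

(** Conditions on a lower set [G] of a thin poset, met by balls of dimension at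
    most one, under which the semisuspension is thin and hence Eulerian. For
    [m = 2] the ball is an arc, whose rim consists of two end points. *)
Section Ball.
Context {d : Order.disp_t} {T : finTPOrderType d} (G : {set T}) (m : nat).
Hypotheses (gT : graded T) (tT : thin T) (pG : pure_ideal G m) (m2 : (m <= 2)%N).
Hypothesis rim0 : rim G m != set0.
Hypothesis above2 : forall x, x \in G -> (rank x).+1 = m -> (#|above G x| <= 2)%N.
Hypothesis card_rim : m = 2 -> #|rim G m| = 2.

Local Notation B := (adjoin_max G).
Local Notation S := (semisuspension B).

Lemma mem_subboundary_rim (u : {x | x \in G}) :
  (Some u \in subboundary B) = (val u \in rim G m).
Proof.
have gB := adjoin_graded gT pG.
rewrite (subboundaryE gB) (adjoin_rank gT pG) (adjoin_poset_rank gT pG) eqSS.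
by rewrite adjoin_midsN [RHS]inE (valP u).
Qed.

Lemma top_subboundary : (None : B) \notin subboundary B.
Proof.
have gB := adjoin_graded gT pG.
by rewrite (subboundaryE gB) -[rank _]/(poset_rank B) gtn_eqF.
Qed.

Lemma card_subboundary : #|subboundary B| = #|rim G m|.
Proof.
apply: card_adjoin => [||u]; [exact: top_subboundary| |exact: mem_subboundary_rim].
by apply/subsetP => x; rewrite inE => /andP[].
Qed.

Let gB : graded B := adjoin_graded gT pG.
Let rB : poset_rank B = m.+1 := adjoin_poset_rank gT pG.

Lemma ball_subboundary0 : subboundary B != set0.
Proof. by rewrite -card_gt0 card_subboundary card_gt0. Qed.

Lemma ball_semi_graded : graded S.
Proof. exact: (semi_graded gB ball_subboundary0 rB). Qed.

Lemma ball_below_thin (x y : B) :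
  y != \top -> x <= y -> rank y = (rank x).+2 -> #|mids x y| = 2.
Proof.
case: x y => [u|] [v|] //; rewrite !(adjoin_rank gT pG) adjoin_le (adjoin_mids pG).
by move=> _; apply: tT.
Qed.

Lemma ball_ridge_le2 (x : B) : (rank x).+1 = m -> (#|mids x \top| <= 2)%N.
Proof.
case: x => [u|]; first by rewrite (adjoin_rank gT pG) adjoin_midsN; apply: above2 (valP u).
by rewrite -[rank _]/(poset_rank B) rB => /eqP; rewrite gtn_eqF.
Qed.

Lemma ball_card_B : m = 2 -> #|subboundary B| = 2.
Proof. by rewrite card_subboundary. Qed.

Lemma ball_near_Eulerian : near_Eulerian B.
Proof.
exact: (semi_near_Eulerian gB ball_subboundary0 rB m2 ball_below_thin ball_ridge_le2
  ball_card_B).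
Qed.

Lemma ball_semi_thin : thin S.
Proof.
exact: (semi_thin gB ball_subboundary0 rB m2 ball_below_thin ball_ridge_le2 ball_card_B).
Qed.

Lemma ball_semi_poset_rank : poset_rank S = m.+1.
Proof. exact: (semi_poset_rank gB ball_subboundary0 rB). Qed.

Lemma ball_semi_coatom (z : S) : (z \in coatom S) =
  if z is Some o then (if o is Some u then rank (val u) == m else false) else true.
Proof.
rewrite coatomE ball_semi_poset_rank eqSS; case: z => [[u|]|].
- by rewrite (semi_rank gB ball_subboundary0 rB) (adjoin_rank gT pG).
- by rewrite (semi_rank gB ball_subboundary0 rB) -[rank _]/(poset_rank B) rB gtn_eqF.
- by rewrite (semi_rankN gB ball_subboundary0 rB) eqxx.
Qed.

Lemma ball_boundary : lower_boundary G = closure (rim G m).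
Proof.
have [_ lG _] := pG; apply/setP => x; apply/imsetP/closureP => [[u + ->]|[y yR xy]].
  rewrite inE => /boundaryP[[v|]]; last by rewrite (negPf top_subboundary).
  by rewrite mem_subboundary_rim => vR uv; exists (val v).
have yG : y \in G by move: yR; rewrite inE => /andP[].
exists (Sub x (lG _ _ xy yG)); rewrite ?SubK // inE; apply/boundaryP.
by exists (Some (Sub y yG)); rewrite ?mem_subboundary_rim ?SubK.
Qed.

Lemma ball_subclass (Pj : {set T}) : closure Pj = G ->
  G = Pj :|: closure (rim G m) -> [disjoint Pj & closure (rim G m)] ->
  (exists P, S_partition P (new_coatom B)) -> SE_subclass m.+1 Pj.
Proof.
move=> cl GU dis SP; rewrite /SE_subclass cl ball_boundary; split=> //.
- by split; [exact: ball_near_Eulerian|].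
- exact: ball_semi_poset_rank.
Qed.

End Ball.

Section Cell.
Context {d : Order.disp_t} {T : finTPOrderType d}.
Hypotheses (gT : graded T) (tT : thin T).

Lemma cell_pure (v : T) : pure_ideal (down v) (rank v).
Proof.
split.
- by apply/set0Pn; exists v; rewrite inE.
- by move=> x y xy; rewrite !inE; apply: le_trans.
- by move=> x; rewrite inE => xv; exists v; rewrite inE lexx.
Qed.

Lemma cell_above (v x : T) :
  x \in down v -> (rank x).+1 = rank v -> above (down v) x = [set v].
Proof.
rewrite inE => xv rx; apply/setP => y; rewrite !inE; apply/andP/eqP => [[yv xy]|->].
  by apply: (le_rank_eq yv); apply/eqP; rewrite eqn_leq rank_le // -rx rank_lt.
rewrite lexx lt_neqAle xv andbT; split=> //.
by apply: contra_eqN rx => /eqP->; rewrite gtn_eqF.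
Qed.

Lemma cell_rim (v : T) : rim (down v) (rank v) = [set x in down v | (rank x).+1 == rank v].
Proof.
apply: eq_finset => x; case xv: (x \in down v) => //=.
by case: eqP => //= rx; rewrite cell_above // cards1.
Qed.

(** A closed cell with its interior alone as sub-class. Its boundary consists of
    all proper faces, and the new coatom is a second copy of the cell glued along
    them, so that the semisuspension is a bigon. *)
Lemma cell_subclass (v : T) n : rank v = n -> (1 <= n <= 2)%N -> SE_subclass n.+1 [set v].
Proof.
move=> rv n12; have /andP[n1 n2] := n12; have pv := cell_pure v; rewrite rv in pv.
have Rv := cell_rim v; rewrite rv in Rv.
have av x : x \in down v -> (rank x).+1 = n -> above (down v) x = [set v].
  by rewrite -rv; apply: cell_above.
have [b bP br] := graded_bottom gT.
have [z zv rz] : exists2 z, z \in down v & (rank z).+1 = n.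
  have [|z /andP[_ zv] rz] := @exists_rank _ _ gT b v n.-1 (bP v).
    by rewrite (bottom_rank bP) rv leq_pred.
  by exists z; rewrite ?inE // rz prednK.
have R0 : rim (down v) n != set0.
  by apply/set0Pn; exists z; rewrite Rv in_set zv rz eqxx.
have a2 x : x \in down v -> (rank x).+1 = n -> (#|above (down v) x| <= 2)%N.
  by move=> xv rx; rewrite av // cards1.
have R2 : n = 2 -> #|rim (down v) n| = 2.
  move=> nn; rewrite -(tT (bP v)); last by rewrite (bottom_rank bP) rv.
  rewrite Rv; apply: eq_card => x; rewrite !inE nn eqSS.
  apply/andP/andP => [[xv /eqP rx]|[bx xv]].
    rewrite !lt_neqAle bP xv eq_sym -br rx !andbT; split=> //.
    by apply: contra_eqN rx => /eqP ->; rewrite rv nn.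
  rewrite ltW // eqn_leq; have := rank_lt xv; have := rank_lt bx.
  by rewrite rv nn (bottom_rank bP) ltnS => -> ->.
have clR : closure (rim (down v) n) = down v :\ v.
  apply/setP => x; rewrite in_setD1; apply/closureP/andP => [[y]|[xv xdv]].
    rewrite Rv in_set inE => /andP[yv /eqP ry] xy; rewrite inE (le_trans xy) //; split=> //.
    apply: contra_eqN ry => /eqP xv; rewrite (@le_anti _ _ y v) ?rv ?gtn_eqF //.
    by rewrite yv -xv.
  move: xdv; rewrite inE => xdv.
  have xv' : x < v by rewrite lt_neqAle xv.
  have := rank_lt xv'; rewrite rv => rx.
  have [|y /andP[xy yv] ry] := @exists_rank _ _ gT x v n.-1 xdv.
    by rewrite rv leq_pred andbT -ltnS prednK.
  by exists y; rewrite // Rv !inE yv ry prednK ?eqxx.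
apply: (ball_subclass gT tT pv n2 R0 a2 R2).
- by rewrite /closure big_set1.
- by rewrite clR setD1K // inE.
- by rewrite clR disjoints1 !inE eqxx.
have vv : v \in down v by rewrite inE.
pose e : semisuspension (adjoin_max (down v)) := Some (Some (Sub v vv)).
apply: (@bigon_S_partition _ _ (new_coatom _) e n) => //.
- exact: (ball_semi_graded gT pv R0).
- exact: (ball_semi_thin gT tT pv n2 R0 a2 R2).
- exact: (ball_semi_poset_rank gT pv R0).
move=> [[u|]|]; rewrite (ball_semi_coatom gT pv R0) !inE //=.
have : val u <= v by have := valP u; rewrite inE.
move=> uv; rewrite (inj_eq (@Some_inj _)) (inj_eq (@Some_inj _)) -val_eqE /=.
apply/eqP/eqP => [ru|->] //; by apply: (le_rank_eq uv); rewrite ru.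
Qed.

End Cell.

Section Triangle.
Context {d : Order.disp_t} {T : finTPOrderType d}.
Hypotheses (gT : graded T) (tT : thin T).
Implicit Types (s t e f v w : T).

Definition edges s : {set T} := [set e | (e <= s) && (rank e == 2)].

(** The combinatorics of a triangle [s] seen from one of its edges [e0]: the two
    other edges share exactly one vertex, the one opposite to [e0]. Everything
    follows from the fact that, by thinness, a vertex of [s] lies on exactly two
    of the three edges. *)
Lemma triangle_structure s e0 : rank s = 3 -> #|edges s| = 3 -> e0 \in edges s ->
  exists e f v, [/\ edges s = [set e0; e; f], uniq [:: e0; e; f],
    rank v = 1, v <= e /\ v <= f & forall w, rank w = 1 -> 
      [/\ w <= s -> ~~ (w <= e0) -> w = v & w <= e -> w <= f -> w = v]].
Proof.
move=> rs cE e0E.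
have [b bP br] := graded_bottom gT.
have /cards2P[e [f [ef E']]] : #|edges s :\ e0| == 2.
  by move: cE; rewrite (cardsD1 e0) e0E add1n => -[->].
have Es : edges s = [set e0; e; f] by rewrite -setUA -E' setD1K.
have ee0 : e != e0.
  by have := set21 e f; rewrite -E' inE in_set1 => /andP[].
have fe0 : f != e0.
  by have := set22 e f; rewrite -E' inE in_set1 => /andP[].
have u3 : uniq [:: e0; e; f] by rewrite /= !inE negb_or eq_sym ee0 eq_sym fe0 ef.
have edgeP g : g \in edges s -> g <= s /\ rank g = 2 by rewrite inE => /andP[? /eqP].
have eE : e \in edges s by rewrite Es !inE eqxx orbT.
have fE : f \in edges s by rewrite Es !inE eqxx !orbT.
have [[e0s re0] [es re] [fs rf]] := And3 (edgeP _ e0E) (edgeP _ eE) (edgeP _ fE).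
have lt_edge w g : rank w = 1 -> g \in edges s -> (w < g) = (w <= g).
  move=> rw /edgeP[_ rg]; rewrite lt_neqAle andbC; case: (w <= g) => //=.
  by apply: contra_eqN rw => /eqP->; rewrite rg.
have H w : rank w = 1 -> w <= s -> ((w <= e0)%O + (w <= e)%O + (w <= f)%O = 2)%N.
  move=> rw ws; transitivity #|mids w s|; last by rewrite tT // rs rw.
  have -> : mids w s = [set g in edges s | w <= g].
    apply/setP => g; rewrite !inE; apply/andP/andP => [[wg gs]|[gE wg]].
      have := rank_lt wg; have := rank_lt gs; rewrite rw rs ltnS => a1 a2.
      by rewrite ltW // ltW // eqn_leq a1 a2.
    have gE' : g \in edges s by rewrite inE.
    have [gs rg] := edgeP _ gE'; rewrite lt_edge // wg lt_neqAle gs andbT; split=> //.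
    by apply: contra_eqN rg => /eqP ->; rewrite rs.
  rewrite -sum1dep_card big_mkcondr Es -setUA.
  rewrite !big_setU1 ?big_set1 ?inE ?negb_or //=; last first.
    by rewrite eq_sym ee0 eq_sym fe0.
  by rewrite addnA; do 3!case: (w <= _).
have ends g : g \in edges s -> exists p q,
    [/\ p != q, rank p = 1 /\ rank q = 1, p <= s /\ q <= s &
      forall w, rank w = 1 -> (w <= g) = (w \in [set p; q])].
  move=> gE; have [gs rg] := edgeP _ gE.
  have /eqP/cards2P[p [q [pq mE]]] : #|mids b g| = 2 by rewrite tT // rg (bottom_rank bP).
  have rm w : w \in mids b g -> rank w = 1 /\ w <= s.
    rewrite inE => /andP[/rank_lt + wg]; rewrite (bottom_rank bP) => w0.
    have := rank_lt wg; rewrite rg ltnS => w1; split; last exact: le_trans (ltW wg) gs.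
    by apply/eqP; rewrite eqn_leq w1 w0.
  have [|rp ps] := rm p; first by rewrite mE !inE eqxx.
  have [|rq qs] := rm q; first by rewrite mE !inE eqxx orbT.
  exists p, q; split=> // w rw; rewrite -mE inE (lt_edge w g) // lt_neqAle bP andbT.
  by rewrite eq_sym -br rw.
have two g x w r : g \in edges s -> rank x = 1 -> rank w = 1 -> rank r = 1 ->
    x <= g -> w <= g -> r <= g -> x != w -> r = x \/ r = w.
  move=> /ends[p [q [_ _ _ gw]]] rx rw rr; rewrite !gw //.
  by move=> /set2P[]-> /set2P[]-> /set2P[]->; rewrite ?eqxx //; auto.
have [p [q [pq [rp rq] [ps qs] e0w]]] := ends _ e0E.
(* If both ends of [e] were on [e0], the two edges would have the same ends;
   then an end of [f] would lie on both or on neither of them, so on three edges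
   or on one. *)
have [x [rx xs xe xe0]] : exists x, [/\ rank x = 1, x <= s, x <= e & ~~ (x <= e0)].
  have [v [v' [vv [rv rv'] [vs vs'] ew]]] := ends _ eE.
  have ve : v <= e by rewrite ew // set21.
  have ve' : v' <= e by rewrite ew // set22.
  have [v0|] := boolP (v <= e0); last by exists v.
  have [v0'|] := boolP (v' <= e0); last by exists v'.
  have [u [u' [_ [ru _] [us _] fw]]] := ends _ fE.
  have uf : u <= f by rewrite fw // set21.
  have := H u ru us; rewrite uf.
  case ue0: (u <= e0); case ue: (u <= e) => // _.
    by have [uv|uv] := two _ _ _ _ e0E rv rv' ru v0 v0' ue0 vv; rewrite uv ?ve ?ve' in ue.
  by have [uv|uv] := two _ _ _ _ eE rv rv' ru ve ve' ue vv; rewrite uv ?v0 ?v0' in ue0.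
have off w : rank w = 1 -> w <= s -> ~~ (w <= e0) -> w <= e /\ w <= f.
  by move=> rw ws /negbTE w0; have := H w rw ws; rewrite w0; do 2!case: (w <= _).
have [_ xf] := off _ rx xs xe0.
(* If [w] and [x] were both off [e0], they would be the two ends of [e] and also
   of [f], leaving no second edge for an end [p] of [e0]. *)
have uniq_v w : rank w = 1 -> w <= s -> ~~ (w <= e0) -> w = x.
  move=> rw ws w0; have [we wf] := off _ rw ws w0.
  apply/eqP; apply: contraT => wx.
  have p0 : p <= e0 by rewrite e0w // set21.
  have absurd g : g \in edges s -> x <= g -> w <= g -> p <= g -> False.
    move=> gE xg wg pg; have [px|pw] := two _ _ _ _ gE rw rx rp wg xg pg wx.
      by rewrite -px p0 in w0.
    by rewrite -pw p0 in xe0.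
  have := H p rp ps; rewrite p0.
  case pe: (p <= e); first by case: (absurd e).
  by case pf: (p <= f) => //; case: (absurd f).
exists e, f, x; split=> // w rw; split; first exact: uniq_v.
move=> we wf; apply: uniq_v => //; first exact: le_trans es.
by have := H w rw (le_trans we es); rewrite we wf; case: (w <= e0).
Qed.

End Triangle.

Section Path.
Context {d : Order.disp_t}.

(** The boundary of a triangle, whichever edge [s1] comes first: the second edge
    [e] takes the vertex [v] opposite to [s1], and the third edge [f] is left
    with nothing else and is terminal. *)
Lemma triangle_S_partition (T : finTPOrderType d) (s1 : T) : 
  graded T -> thin T -> poset_rank T = 3 -> #|coatom T| = 3 ->
  s1 \in coatom T -> exists P, S_partition P s1.
Proof.
move=> gT tT rT cT s1c.
have edgesE : edges \top =i coatom T by move=> x; rewrite inE lex1 coatomE rT.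
have [||e [f [v [E u3 rv [ve vf] vP]]]] := @triangle_structure _ _ gT tT \top s1 rT.
- by rewrite (eq_card edgesE).
- by rewrite edgesE.
have rk (x : T) : x != \top -> (rank x <= 2)%N.
  by rewrite -ltx1 => /rank_lt; rewrite rank_topE rT.
have [b bP br] := graded_bottom gT.
have coat (x : T) : x != \top -> ~~ (x <= s1) -> x != v ->
    x \in coatom T /\ (x == e) || (x == f).
  move=> xt xs xv; have xc : x \in coatom T.
    rewrite coatomE rT eqSS; have := rk _ xt; case rx: (rank x) => [|[|[|]]] // _.
      by move/eqP: rx xs; rewrite br => /eqP->; rewrite bP.
    by have [/(_ (lex1 x) xs)] := vP x rx; move/eqP: xv.
  split=> //; move: xc; rewrite -edgesE E !inE -orbA.
  case/or3P=> [/eqP xs1|->|->]; rewrite ?orbT //.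
  by rewrite xs1 lexx in xs.
have [es1 fs1 fe] : [/\ e != s1, f != s1 & f != e].
  move: u3; rewrite /= !inE negb_or andbT => /andP[/andP[a1 a2] a3].
  by split; rewrite eq_sym.
have ec : e \in coatom T by rewrite -edgesE E !inE eqxx orbT.
have fc : f \in coatom T by rewrite -edgesE E !inE eqxx !orbT.
(* Otherwise [v] would lie on all three edges. *)
have vs1 : ~~ (v <= s1).
  apply/negP => vs1; have vt : v <= \top by rewrite lex1.
  have := tT _ _ vt; rewrite rank_topE rT rv => /(_ erefl) m2.
  have : [set s1; e; f] \subset mids v \top.
    rewrite -E; apply/subsetP => g; rewrite edgesE => gc; rewrite inE.
    rewrite !lt_neqAle lex1 coatom_neq_top // !andbT.
    have rg : rank g = 2 by apply/eqP; rewrite -eqSS -rT -coatomE.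
    rewrite (_ : v <= g) ?andbT; first by apply: contra_eqN rv => /eqP ->; rewrite rg.
    by move: gc; rewrite -edgesE E !inE -orbA => /or3P[]/eqP->.
  move/subset_leq_card; rewrite m2 -E (eq_card edgesE) cT //.
pose o x := if x <= s1 then s1 else if x == v then e else x.
exists (owner_class o); apply: (@S_partition_owner _ _ _ _ f 2) => //.
- move=> x xt; rewrite /o; case: ifPn => [//|xs]; have [->//|xv] := eqVneq x v.
  by have [] := coat _ xt xs xv.
- move=> x xt; rewrite /o; case: ifPn => [_|xs]; first by rewrite eqxx.
  have [_|xv] := eqVneq x v; first by rewrite (negPf es1).
  by apply: contraNF xs => /eqP->.
- move=> x xt; rewrite /o; case: ifPn => [_ e1|xs]; first by rewrite -e1 eqxx in fs1.
  by have [_ e1|//] := eqVneq x v; rewrite -e1 eqxx in fe.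
- move=> s sc ss1 sf; have se : s = e.
    by move: sc; rewrite -edgesE E !inE -orbA (negPf ss1) (negPf sf) orbF => /eqP.
  have -> : owner_class o s :\ s = [set v].
    have ve' : v != e.
      by apply: contra_eqN rv => /eqP->; move: ec; rewrite coatomE rT eqSS => /eqP->.
    have vt : v != \top by rewrite -rank_top rT rv.
    apply/setP => x; rewrite in_setD1 !inE se; apply/idP/eqP => [/and3P[xe xt]|->].
      rewrite /o; case: ifPn => [_|xs]; first by rewrite eq_sym (negPf es1).
      by have [//|xv] := eqVneq x v; rewrite (negPf xe).
    by rewrite ve' vt /o (negPf vs1) !eqxx.
  split; first by apply/set0Pn; exists v; rewrite inE.
  exact: cell_subclass.
- apply: (boundary_S_partitionable gT tT (n := 2)) => //.
  by apply/eqP; rewrite -eqSS -rT -coatomE.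
Qed.

(** Two edges [e] and [f] glued at [c], with the interior of this arc as
    sub-class. The boundary consists of the two outer end points (and the
    minimum), and the new coatom closes the arc to a triangle. *)
Lemma path_subclass (T : finTPOrderType d) (c e f : T) : graded T -> thin T ->
  rank c = 1 -> rank e = 2 -> rank f = 2 -> e != f -> c <= e -> c <= f ->
  (forall w, rank w = 1 -> w <= e -> w <= f -> w = c) ->
  SE_subclass 3 [set c; e; f].
Proof.
move=> gT tT rc re rf ef ce cf cU.
have [b bP br] := graded_bottom gT.
pose G := down e :|: down f.
have inG x : (x \in G) = (x <= e) || (x <= f) by rewrite !inE.
have pG : pure_ideal G 2.
  split.
  - by apply/set0Pn; exists b; rewrite inG bP.
  - by move=> x y xy; rewrite !inG => /orP[]/(le_trans xy)->; rewrite ?orbT.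
  - move=> x; rewrite inG => /orP[xe|xf]; [exists e | exists f];
    by rewrite inG lexx ?orbT.
have edge_lt (g x : T) : rank g = 2 -> rank x = 1 -> (x < g) = (x <= g).
  move=> rg rx; rewrite lt_neqAle andbC; case: (x <= g) => //=.
  by apply: contra_eqN rx => /eqP->; rewrite rg.
have aboveE (x : T) : rank x = 1 -> above G x = [set g in [set e; f] | x <= g].
  move=> rx; apply/setP => g; rewrite [LHS]in_set inG [RHS]in_set in_set2.
  apply/andP/andP => [[gG xg]|[/pred2P[]-> xg]]; last 2 first.
  - by rewrite lexx edge_lt.
  - by rewrite lexx orbT edge_lt.
  have g2 : (1 < rank g)%N by rewrite -rx rank_lt.
  split; last exact: ltW.
  case/orP: gG => gl; apply/orP; [left|right]; apply/eqP/(le_rank_eq gl)/eqP.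
    by rewrite eqn_leq rank_le // re.
  by rewrite eqn_leq rank_le // rf.
have above_in x (g : T) : rank x = 1 -> x <= g -> ~~ (x <= if g == e then f else e) ->
    g \in [set e; f] -> above G x = [set g].
  move=> rx xg xg' gef; rewrite aboveE //; apply/setP => h; rewrite !inE.
  apply/andP/eqP => [[/pred2P[]-> xh]|->]; last by rewrite -in_set2.
    by move: xg'; case: eqP => // _; rewrite xh.
  move: xg'; case: eqP => [_|ge _]; first by rewrite xh.
  by move: gef; rewrite in_set2 => /pred2P[].
(* The end of [g] other than [c]. *)
have other (g h : T) : rank g = 2 -> rank h = 2 -> c <= g ->
    (forall w, rank w = 1 -> w <= g -> w <= h -> w = c) ->
    exists a, [/\ rank a = 1, a <= g, ~~ (a <= h) &
                forall w, rank w = 1 -> w <= g -> w = a \/ w = c].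
  move=> rg rh cg gh.
  have bg : #|mids b g| = 2 by rewrite tT // rg (bottom_rank bP).
  have in_b w : rank w = 1 -> w <= g -> w \in mids b g.
    by move=> rw wg; rewrite inE (edge_lt g w) // wg andbT lt_neqAle bP eq_sym -br rw.
  have cb := in_b _ rc cg.
  have /cards1P[a aE] : #|mids b g :\ c| == 1.
    by move: bg; rewrite (cardsD1 c) cb add1n => -[->].
  have : a \in mids b g :\ c by rewrite aE inE.
  rewrite !inE => /and3P[ac /rank_lt ba ag]; rewrite (bottom_rank bP) in ba.
  have ra : rank a = 1.
    by have := rank_lt ag; rewrite rg ltnS => a1; apply/eqP; rewrite eqn_leq a1.
  exists a; split=> //; first exact: ltW.
    by apply: contra ac => ah; apply/eqP/gh => //; apply: ltW.
  move=> w rw wg; have [->|wc] := eqVneq w c; [by right|left].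
  have : w \in mids b g :\ c by rewrite in_setD1 wc in_b.
  by rewrite aE inE => /eqP.
have [a [ra ae af aP]] := other _ _ re rf ce cU.
have [a' [ra' af' ae' aP']] : exists a, [/\ rank a = 1, a <= f, ~~ (a <= e) &
                forall w, rank w = 1 -> w <= f -> w = a \/ w = c].
  by apply: other => // w rw wf we; apply: cU.
have aa' : a != a' by apply: contraNneq af => ->.
have rimE : rim G 2 = [set a; a'].
  have inRa : a \in rim G 2.
    rewrite inE inG ae ra /= (@above_in a e) ?cards1 ?eqxx //; exact: set21.
  have inRa' : a' \in rim G 2.
    rewrite inE inG af' ra' orbT /=.
    by rewrite (@above_in a' f) ?cards1 ?(eq_sym f) ?(negPf ef) // set22.
  apply/eqP; rewrite eqEsubset; apply/andP; split; last first.
    by apply/subsetP => x /set2P[]->.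
  apply/subsetP => x; rewrite [x \in rim _ _]in_set inG eqSS => /and3P[xef /eqP rx ax].
  rewrite in_set2; have xc : x != c.
    apply: contraL ax => /eqP->; rewrite aboveE //.
    rewrite (_ : [set g in _ | _] = [set e; f]) ?cards2 ?ef //.
    by apply/setP => g; rewrite in_set in_set2; apply/andb_idr => /pred2P[]->.
  by case/orP: xef => [/(aP _ rx)|/(aP' _ rx)] [->|/eqP]; rewrite ?eqxx ?orbT // (negPf xc).
have R0 : rim G 2 != set0 by rewrite rimE; apply/set0Pn; exists a; apply: set21.
have R2 : 2 = 2 -> #|rim G 2| = 2 by rewrite rimE cards2 aa'.
have a2 x : x \in G -> (rank x).+1 = 2 -> (#|above G x| <= 2)%N.
  move=> _ [rx]; rewrite aboveE //; apply: leq_trans (_ : #|[set e; f]| <= 2)%N.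
    by apply/subset_leq_card/subsetP => g; rewrite in_set => /andP[].
  by rewrite cards2 ef.
have clR : closure (rim G 2) = [set b; a; a'].
  apply/setP => x; rewrite rimE; apply/closureP/idP => [[y yR xy]|].
    have ry : rank y = 1 by move: yR => /set2P[]->.
    move: xy; rewrite le_eqVlt => /predU1P[->|/rank_lt].
      by rewrite -setUA in_setU yR orbT.
    by rewrite ry ltnS leqn0 br => /eqP->; rewrite !inE eqxx.
  rewrite -setUA => /setU1P[->|xR]; last by exists x.
  by exists a; rewrite ?set21.
have ball x : x \in G -> x \in [set c; e; f] \/ x \in [set b; a; a'].
  rewrite inG => xef; have : (rank x <= 2)%N by case/orP: xef => /rank_le; rewrite ?re ?rf.
  case rx: (rank x) => [|[|[|]]] // _.
  - by right; move/eqP: rx; rewrite br => /eqP->; rewrite !inE eqxx.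
  - by case/orP: xef => [/(aP _ rx)|/(aP' _ rx)] []->; rewrite !inE eqxx ?orbT; auto.
  left; case/orP: xef => [xe|xf].
    by rewrite (le_rank_eq xe) ?rx ?re // !inE eqxx orbT.
  by rewrite (le_rank_eq xf) ?rx ?rf // !inE eqxx !orbT.
have rb : rank b = 0%N := bottom_rank bP.
apply: (ball_subclass gT tT pG isT R0 a2 R2).
- apply/setP => x; rewrite inG; apply/closureP/orP => [[y]|[xe|xf]].
  + by rewrite !inE -orbA => /or3P[]/eqP-> xy; [left; apply: le_trans ce| left | right].
  + by exists e; rewrite // !inE eqxx orbT.
  + by exists f; rewrite // !inE eqxx orbT.
- rewrite clR; apply/setP => x; rewrite in_setU; apply/idP/orP => [/ball //|].
  rewrite inG; case; rewrite !inE -orbA => /or3P[]/eqP->;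
    by rewrite ?ce ?lexx ?orbT ?bP ?ae ?af' ?orbT.
- rewrite clR; apply/pred0P => x /=; apply/negP => /andP[].
  have ca : c != a by apply: contraNneq af => <-.
  have ca' : c != a' by apply: contraNneq ae' => <-.
  rewrite !inE -!orbA => /or3P[]/eqP-> /or3P[]/eqP xx;
    move: (congr1 (@rank _ T) xx); rewrite ?rc ?re ?rf ?rb ?ra ?ra' //.
  + by rewrite xx eqxx in ca.
  + by rewrite xx eqxx in ca'.
have eG : e \in G by rewrite inG lexx.
have fG : f \in G by rewrite inG lexx orbT.
pose S := semisuspension (adjoin_max G).
have gS : graded S := ball_semi_graded gT pG R0.
have tS : thin S := ball_semi_thin gT tT pG isT R0 a2 R2.
(* In the semisuspension the maximum of [adjoin_max G] is [Some None] and the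
   new coatom is [None]. *)
pose e' : S := Some (Some (Sub e eG)); pose f' : S := Some (Some (Sub f fG)).
have cS : coatom S =i [set (None : S); e'; f'].
  move=> [[u|]|]; rewrite (ball_semi_coatom gT pG R0) !inE //=.
  rewrite !(inj_eq (@Some_inj _)) -!val_eqE /=.
  apply/eqP/orP => [ru|[]/eqP->//].
  have := valP u; rewrite inG => /orP[] ul; [left|right];
    by apply/eqP/(le_rank_eq ul); rewrite ru.
apply: (@triangle_S_partition _ (new_coatom (adjoin_max G)) gS tS).
- exact: (ball_semi_poset_rank gT pG R0).
- rewrite (eq_card cS) -setUA cardsU1 cards2 !inE /=.
  by rewrite !(inj_eq (@Some_inj _)) -val_eqE /= ef.
- by rewrite cS !inE eqxx.
Qed.

End Path.

(** * Surfaces *)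

Lemma connect_dist (I : finType) (e : rel I) (x : I) : exists dist : I -> nat,
  forall y, connect e x y -> y != x ->
  exists z, [/\ connect e x z, e z y & (dist z < dist y)%N].
Proof.
pose D y n := [exists p : n.-tuple I, path e x p && (last x p == y)].
have DP y p : path e x p -> last x p = y -> D y (size p).
  by move=> pp pl; apply/existsP; exists (in_tuple p); rewrite pp pl eqxx.
have [|dist distP] := @fin_all_exists I (fun=> nat)
    (fun y n => connect e x y -> D y n /\ forall m, D y m -> (n <= m)%N).
  move=> y; have [xy|nxy] := boolP (connect e x y); last by exists 0%N => xy; case/negP: nxy.
  have exD : exists n, D y n by have /connectP[p pp yp] := xy; exists (size p); apply: DP.
  by case: (ex_minnP exD) => n Dn nmin; exists n.
exists dist => y xy yx; have [/existsP[p /andP[pp /eqP pl]] _] := distP y xy.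
case/lastP: {p}(tval p) (size_tuple p) pp pl => [|p w] sp.
  by move=> _ /esym/eqP; rewrite /= (negPf yx).
rewrite rcons_path last_rcons => /andP[pp ew] wy; rewrite wy in ew.
have xz : connect e x (last x p) by apply/connectP; exists p.
exists (last x p); split=> //; have [_] := distP _ xz.
by move=> /(_ _ (DP _ _ pp erefl)); rewrite -sp size_rcons ltnS.
Qed.

(** Breadth-first numbering of a component. The index in an enumeration breaks the
    ties between elements at equal distance from [x]. *)
Lemma connect_order (I : finType) (e : rel I) (x : I) : exists2 pos : I -> nat, injective pos &
  forall y, connect e x y -> y != x ->
  exists z, [/\ connect e x z, e z y & (pos z < pos y)%N].
Proof.
have [dist distP] := connect_dist e x.
pose pos y := (dist y * #|I| + enum_rank y)%N.
have posE y : (pos y %/ #|I| = dist y)%N /\ (pos y %% #|I| = enum_rank y)%N.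
  have I0 : (0 < #|I|)%N := leq_ltn_trans (leq0n _) (ltn_ord (enum_rank y)).
  by rewrite /pos divnMDl // modnMDl divn_small ?modn_small ?addn0.
exists pos => [y z yz|y xy yx].
  by apply/enum_rank_inj/val_inj; rewrite /= -(posE y).2 yz (posE z).2.
have [z [xz ezy zy]] := distP y xy yx; exists z; split=> //.
rewrite /pos; apply: leq_trans (leq_addr _ _); apply: leq_trans (leq_mul zy (leqnn _)).
by rewrite mulSn addnC ltn_add2r.
Qed.

(** The order-theoretic trace of a triangulated surface, possibly with singular
    vertices: a thin poset of rank four whose coatoms have three edges. *)
Section Surface.
Context {d : Order.disp_t} (T : finTPOrderType d).
Hypotheses (gT : graded T) (tT : thin T) (rT : poset_rank T = 4).
Hypothesis triangles : forall s, s \in coatom T -> #|edges s| = 3.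

Definition adjacent : rel T :=
  [rel s t | [&& s \in coatom T, t \in coatom T & [exists r, (r \in edges s) && (r <= t)]]].

Lemma coatom_rank s : s \in coatom T -> rank s = 3.
Proof. by rewrite coatomE rT => /eqP[]. Qed.

Lemma triangle_boundary_S_partitionable s : s \in coatom T ->
  S_partitionable (adjoin_max (down s :\ s)) /\ poset_rank (adjoin_max (down s :\ s)) = 3.
Proof.
move=> sc; have rs := coatom_rank sc.
have gB := boundary_graded gT rs; have tB := boundary_thin gT tT rs.
have rB := boundary_poset_rank gT rs; split=> //.
have cB : #|coatom (adjoin_max (down s :\ s))| = 3.
  rewrite -(triangles sc) -(cardsE (coatom _)); apply: card_adjoin => [||u].
  - by rewrite inE; apply/negP => /coatom_neq_top/eqP.
  - apply/subsetP => x; rewrite !inE => /andP[xs /eqP rx]; rewrite xs andbT.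
    by apply: contra_eqN rx => /eqP->; rewrite rs.
  - rewrite inE coatomE rB (adjoin_rank gT (boundary_pure gT rs)) eqSS [RHS]inE.
    by have := valP u; rewrite !inE => /andP[_ ->].
have /card_gt0P[s1 s1c] : (0 < #|coatom (adjoin_max (down s :\ s))|)%N by rewrite cB.
have [P SP] := triangle_S_partition gB tB rB cB s1c.
exact: S_partitionable_via SP.
Qed.

Section Order.
Variables (s1 : T) (pos : T -> nat).
Hypotheses (s1c : s1 \in coatom T) (pos_inj : injective pos).
Hypothesis posP : forall s, s \in coatom T -> s != s1 ->
  exists2 t, adjacent t s & (pos t < pos s)%N.

Lemma pos_min s : s \in coatom T -> (pos s1 <= pos s)%N.
Proof.
move=> sc; case: (@arg_minnP _ s1 (mem (coatom T)) pos s1c) => t tc tmin.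
have [<-|ts1] := eqVneq t s1; first exact: tmin.
have [u /and3P[uc _ _]] := posP tc ts1.
by rewrite ltnNge tmin.
Qed.

Lemma exists_owner : exists o : T -> T, forall x, x != \top ->
  [/\ o x \in coatom T, x <= o x &
      forall t, t \in coatom T -> x <= t -> (pos (o x) <= pos t)%N].
Proof.
pose owns x s := x != \top -> [/\ s \in coatom T, x <= s &
  forall t, t \in coatom T -> x <= t -> (pos s <= pos t)%N].
suff ex x : exists s, owns x s by have [o oP] := fin_all_exists ex; exists o.
rewrite /owns; have [->|xt] := eqVneq x \top; first by exists \top.
have [s xs sc] := exists_coatom gT xt.
have Ps : (s \in coatom T) && (x <= s) by rewrite sc.
case: (@arg_minnP _ s (fun s => (s \in coatom T) && (x <= s)) pos Ps) => t /andP[tc xt'] tmin.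
by exists t => _; split=> // u uc xu; apply: tmin; rewrite uc.
Qed.

Section New.
Variable o : T -> T.
Hypothesis oP : forall x, x != \top ->
  [/\ o x \in coatom T, x <= o x &
      forall t, t \in coatom T -> x <= t -> (pos (o x) <= pos t)%N].

Lemma below_coatom_neq_top s x : s \in coatom T -> x <= s -> x != \top.
Proof.
move=> sc xs; apply: contraTneq (coatom_neq_top sc) => xt.
by rewrite negbK -le1x -xt.
Qed.

Lemma owner_first : forall x, x != \top -> (o x == s1) = (x <= s1).
Proof.
move=> x xt; have [oc xo omin] := oP xt; apply/eqP/idP => [<-//|xs1].
by apply/pos_inj/eqP; rewrite eqn_leq omin // pos_min.
Qed.

(** If [s] is the first coatom above [x], it is also the first above any face
    between [x] and [s], since fewer coatoms contain a larger face. *)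
Lemma owner_up s x y : s \in coatom T -> x <= y -> y <= s -> o x = s -> o y = s.
Proof.
move=> sc xy ys ox; have yt := below_coatom_neq_top sc ys.
have [_ _ xmin] := oP (below_coatom_neq_top sc (le_trans xy ys)).
have [oyc yo ymin] := oP yt; apply/pos_inj/eqP; rewrite eqn_leq ymin //=.
by rewrite -ox xmin // (le_trans xy).
Qed.

(** The faces that a triangle [s] adds to the earlier ones. It shares an edge [r]
    with an earlier triangle, so only the two other edges [e], [f] and their
    common vertex [v] can be new. If [v] is new, so are [e] and [f], and the new
    faces form the interior of an arc. If [v] is old, the new faces are single
    edges with old ends, to be put in separate sub-classes. *)
Lemma new_faces s (N := owner_class o s :\ s) : s \in coatom T -> s != s1 ->
  SE_subclass 3 N \/ {in N, forall x, SE_subclass 3 [set x]}.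
Proof.
move=> sc ss1; have rs := coatom_rank sc.
have [b bP br] := graded_bottom gT.
have NE x : (x \in N) = (x != s) && (x != \top) && (o x == s) by rewrite !inE andbA.
have Nlt x : x \in N -> x < s.
  rewrite NE => /andP[/andP[xs xt] /eqP ox]; rewrite lt_neqAle xs.
  by have [_ + _] := oP xt; rewrite ox.
have [t /and3P[tc _ /existsP[r /andP[rE rs']]] pts] := posP sc ss1.
move: rE rs'; rewrite inE => /andP[rt /eqP rr] rles.
have old x : x \in N -> ~~ (x <= r).
  move=> xN; apply/negP => xr; have := xN; rewrite NE => /andP[/andP[_ xt] /eqP ox].
  have [_ _ /(_ _ tc (le_trans xr rt))] := oP xt.
  by rewrite ox leqNgt pts.
have rE : r \in edges s by rewrite inE rles rr.
have [e [f [v [E u3 rv [ve vf] vP]]]] := triangle_structure gT tT rs (triangles sc) rE.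
have eE : e \in edges s by rewrite E !inE eqxx orbT.
have fE : f \in edges s by rewrite E !inE eqxx !orbT.
have [[es /eqP re] [fs /eqP rf]] : (e <= s /\ rank e == 2) /\ (f <= s /\ rank f == 2).
  by move: eE fE; rewrite !inE => /andP[? ?] /andP[? ?].
have ef : e != f by move: u3; rewrite /= !inE => /and3P[_ ->].
have Nsub x : x \in N -> [\/ x = v, x = e | x = f].
  move=> xN; have xs := Nlt _ xN; have xr := old _ xN.
  have := rank_lt xs; rewrite rs; case rx: (rank x) => [|[|[|]]] // _.
  - by move/eqP: rx xr; rewrite br => /eqP->; rewrite bP.
  - by have [/(_ (ltW xs) xr) ->] := vP x rx; constructor 1.
  have : x \in edges s by rewrite inE ltW ?rx.
  rewrite E !inE -orbA => /or3P[]/eqP xE; [|by constructor 2|by constructor 3].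
  by rewrite xE lexx in xr.
have edge_neq g : rank g = 2 -> g != s.
  by move=> rg; apply: contra_eqN rg => /eqP->; rewrite rs.
have [vN|vN] := boolP (v \in N).
  have upN g : rank g = 2 -> g <= s -> v <= g -> g \in N.
    move=> rg gs vg; rewrite NE edge_neq // (below_coatom_neq_top sc gs) /=.
    by apply/eqP/(owner_up sc vg gs)/eqP; move: vN; rewrite NE => /andP[].
  left; have -> : N = [set v; e; f].
    apply/eqP; rewrite eqEsubset; apply/andP; split; apply/subsetP => x.
      by move=> /Nsub[]->; rewrite !inE eqxx ?orbT.
    by rewrite -setUA => /setU1P[->//|/set2P[]->]; apply: upN.
  by apply: path_subclass => // w rw we wf; have [_ ->] := vP w rw.
right=> x xN; apply: cell_subclass => //.
by case: (Nsub x xN) => xE; rewrite xE // in vN *; rewrite -xE xN in vN.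
Qed.

End New.

Lemma surface_SE_partition : exists P, SE_partition 3 P s1.
Proof.
have [o oP] := exists_owner.
have o1 := owner_first oP.
have oP' x : x != \top -> o x \in coatom T /\ x <= o x by move=> /oP[].
have [|P1 init1] := owner_initial gT s1c _ o1; first by rewrite coatom_rank.
exists (owner_class o); split=> //; first exact: owner_partition.
  by rewrite P1; apply: triangle_boundary_S_partitionable.
move=> s sc ss1; set N := owner_class o s :\ s.
(* All three edges of [s] are old: its class is [s] alone. *)
have [N0|N0] := eqVneq N set0.
  left; rewrite -[owner_class o s](setD1K (mem_owner_class oP' sc)).
  by rewrite [_ :\ s]N0 setU0.
right; have [SN|SN] := new_faces oP sc ss1.
  exists [set N]; rewrite cards1; split=> // [|Pj /set1P->] //.
  by rewrite /partition cover1 trivIset1 eqxx inE eq_sym N0.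
exists [set [set x] | x in N]; split.
- by rewrite card_gt0; have /set0Pn[x xN] := N0; apply/set0Pn; exists [set x]; rewrite imset_f.
- apply/and3P; split.
  + rewrite cover_imset; apply/eqP/setP => x.
    by apply/bigcupP/idP => [[y yN /set1P->]|xN] //; exists x => //; apply: set11.
  + apply/trivIsetP => _ _ /imsetP[x _ ->] /imsetP[y _ ->] xy.
    by rewrite disjoints1 inE; apply: contra xy => /eqP->.
  + by apply/imsetP => -[x _ /setP/(_ x)]; rewrite !inE eqxx.
- by move=> _ /imsetP[x xN ->]; apply: SN.
Qed.

End Order.

Theorem surface_SE_partitionable s1 : s1 \in coatom T ->
  (forall s, s \in coatom T -> connect adjacent s1 s) -> SE_partitionable T.
Proof.
move=> s1c conn; split; first by apply: thin_semi_Eulerian; rewrite // rT.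
right; have [pos pos_inj posP] := connect_order adjacent s1.
have [|P SP] := surface_SE_partition s1c pos_inj.
  by move=> s sc ss1; have [t [_ ts pts]] := posP s (conn s sc) ss1; exists t.
by exists 3%N, P, s1.
Qed.

End Surface.

(** * Simplicial complexes *)

Section Complexes.
Context {V : finType}.
Implicit Types (A B : {set V}) (K : {set {set V}}).

Lemma subset_le A B : (A <= B) = (A \subset B).
Proof. by []. Qed.

Lemma subset_gradedE : graded {set V} /\ forall A, rank A = #|A|.
Proof.
apply: (@gradedP _ _ _ set0) => [A||A B]; rewrite ?cards0 //.
  by rewrite subset_le sub0set.
move=> /andP[]; rewrite lt_def subset_le => /andP[BA AB] /forallP H.
have /properP[_ [x xB xA]] : A \proper B by rewrite properEneq eq_sym BA.
suff <- : x |: A = B by rewrite cardsU1 xA.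
have xAB : x |: A \subset B by rewrite subUset sub1set xB.
apply/eqP; apply: contraNT (H (x |: A)) => ne.
rewrite !lt_neqAle !subset_le ne xAB subsetU1 !andbT.
by apply: contra xA => /eqP->; apply: setU11.
Qed.

Lemma subset_graded : graded {set V}.
Proof. exact: subset_gradedE.1. Qed.

Lemma subset_rank A : rank A = #|A|.
Proof. exact: subset_gradedE.2. Qed.

Lemma subset_thin : thin {set V}.
Proof.
move=> A B; rewrite subset_le !subset_rank => AB cB.
have /eqP/cards2P[x [y [xy BA]]] : #|B :\: A| = 2.
  by rewrite cardsD (setIidPr AB) cB -addn2 addKn.
have [/andP[xA xB] /andP[yA yB]] : (x \notin A) && (x \in B) /\ (y \notin A) && (y \in B).
  by have := set21 x y; have := set22 x y; rewrite -BA !inE => -> ->.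
have -> : mids A B = [set x |: A; y |: A].
  apply/setP => C; rewrite inE in_set2 !lt_neqAle !subset_le.
  apply/andP/pred2P => [[/andP[AC sAC] /andP[CB sCB]]|].
    have /properP[_ [z zC zA]] : A \proper C by rewrite properEneq AC.
    have /proper_card cC : C \proper B by rewrite properEneq CB.
    have zxy : z \in [set x; y] by rewrite -BA inE zA (subsetP sCB).
    have zE : z |: A = C.
      by apply/eqP; rewrite eqEcard cardsU1 zA subUset sub1set zC sAC -ltnS -cB.
    by rewrite -zE; case/set2P: zxy => ->; [left | right].
  have insert u v : u \notin A -> u \in B -> v \in B -> v \notin A -> u != v ->
      (A != u |: A) && (A \subset u |: A) /\ (u |: A != B) && (u |: A \subset B).
    move=> uA uB vB vA uv; rewrite subsetU1 subUset sub1set uB AB !andbT; split.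
      by apply: contra uA => /eqP->; apply: setU11.
    by apply: contraTneq vB => <-; rewrite !inE eq_sym (negPf uv).
  by case=> ->; [apply: (insert x y) | apply: (insert y x); rewrite // eq_sym].
rewrite cards2; apply/eqP; rewrite eqSS eqb1; apply: contra xy => /eqP/setP/(_ x).
by rewrite !inE eqxx (negPf xA) !orbF => /esym.
Qed.

Variable K : {set {set V}}.
Hypothesis pK : pseudomanifold K 2.

Lemma face_card A : A \in K -> (#|A| <= 3)%N.
Proof.
by have [_ [<- _] _ _] := pK; apply: (leq_bigmax_cond (F := fun A : {set V} => #|A|)).
Qed.

Lemma facetE A : facet K A = (A \in K) && (#|A| == 3).
Proof.
apply/idP/andP => [fA|[AK /eqP cA]].
  have [_ [_ fK] _ _] := pK; rewrite fK // eqxx; split=> //.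
  by case/maxsetP: fA.
apply/maxsetP; split=> // B BK AB; apply/eqP; rewrite eq_sym eqEcard AB cA.
exact: face_card.
Qed.

Lemma complex_pure : pure_ideal K 3.
Proof.
have [[K0 lK] _ _ _] := pK; split.
- by apply/set0Pn; exists set0.
- by move=> A B; rewrite subset_le => AB /lK; apply.
- move=> A AK; have [F fF AF] := @maxset_exists _ (mem K) A AK.
  have : facet K F by []; rewrite facetE => /andP[FK /eqP cF].
  by exists F; rewrite subset_le subset_rank.
Qed.

Local Notation FP := (face_poset K).
Local Notation sg := subset_graded.

Lemma face_graded : graded FP. Proof. exact: (adjoin_graded sg complex_pure). Qed.

Lemma face_poset_rank : poset_rank FP = 4.
Proof. exact: (adjoin_poset_rank sg complex_pure). Qed.

Lemma face_rank (u : {A | A \in K}) : rank (Some u : FP) = #|val u|.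
Proof. by rewrite (adjoin_rank sg complex_pure) subset_rank. Qed.

Lemma face_thin : thin FP.
Proof.
apply: (adjoin_thin sg complex_pure subset_thin) => A AK; rewrite subset_rank => -[cA].
have [_ _ /(_ A) + _] := pK; rewrite /ridge AK -cA eqxx => <- //.
apply: eq_card => B; rewrite !inE facetE lt_neqAle subset_le -andbA.
case BK: (B \in K) => //=; case AB: (A \subset B); rewrite ?andbF // !andbT.
apply/idP/eqP => [nAB|cB]; last by apply: contra_eq_neq cA => ->; rewrite cB.
apply/eqP; rewrite eqn_leq face_card //=.
have /proper_card : A \proper B by rewrite properEneq nAB.
by rewrite -cA.
Qed.

Lemma face_coatom (u : {A | A \in K}) : ((Some u : FP) \in coatom FP) = facet K (val u).
Proof. by rewrite coatomE face_rank face_poset_rank facetE (valP u) eqSS. Qed.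

Lemma face_triangles (s : FP) : s \in coatom FP -> #|edges s| = 3.
Proof.
case: s => [u|]; last by move/coatom_neq_top/eqP.
rewrite face_coatom facetE => /andP[uK /eqP cu].
rewrite -[RHS]/('C(3, 2)) -cu -cards_draws.
have [[_ lK] _ _ _] := pK; apply: card_adjoin => [||w].
- by rewrite inE.
- by apply/subsetP => A; rewrite inE => /andP[Au _]; apply: lK Au.
- by rewrite [LHS]inE [RHS]inE face_rank.
Qed.

(** Facets that share a ridge become coatoms that share an edge, so paths of
    adjacent facets map to paths. *)
Lemma face_connect (s t : FP) : s \in coatom FP -> t \in coatom FP ->
  connect (@adjacent _ FP) s t.
Proof.
case: s => [u|]; last by move/coatom_neq_top/eqP.
case: t => [w|]; last by move=> _ /coatom_neq_top/eqP.
rewrite !face_coatom => fu fw; have [[_ lK] _ _ /(_ _ _ fu fw)/connectP[p pp pl]] := pK.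
elim: p u fu pp pl => [|A p IH] u fu /=; first by move=> _ /val_inj->; apply: connect0.
case/andP=> /and3P[_ fA /andP[rK /eqP cR]] pp pl.
have AK : A \in K by move: fA; rewrite facetE => /andP[].
apply: (@connect_trans _ _ (Some (Sub A AK))); last by apply: IH.
apply/connect1/and3P; split; rewrite ?face_coatom //.
apply/existsP; exists (Some (Sub (val u :&: A) rK)).
by rewrite inE face_rank !adjoin_le !SubK !subset_le subsetIl subsetIr cR.
Qed.

End Complexes.

Theorem proposition4p5 (V : finType) (K : {set {set V}}) :
  pseudomanifold K 2 -> SE_partitionable (face_poset K).
Proof.
move=> pK; have [b bP _] := graded_bottom (face_graded pK).
have [|s1 _ s1c] := exists_coatom (face_graded pK) (x := b).
  by rewrite -rank_top (bottom_rank bP) face_poset_rank.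
apply: (surface_SE_partitionable (face_graded pK) (face_thin pK) (face_poset_rank pK)
  (face_triangles pK) s1c) => s; exact: face_connect.
Qed.
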